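(* Let $\Omega$ be a region of $\mathbb{C}$ and let $F:\Omega\to\mathbb{M}_n$ be analytic. Suppose there is $z_0\in\Omega$ such that $\|F(z)\|\leq\|F(z_0)\|$ for all $z\in\Omega$, and set \[d=\dim\{x\in\mathbb{C}^n:\ \|F(z_0)x\|=\|F(z_0)\|\cdot\|x\|\}.\] Then there are $n\times n$ unitary matrices $U$ and $V$ such that $F(z)=\|F(z_0)\|\,UV$ for all $z\in\Omega$ when $d=n$, or, when $d<n$, there is in addition an analytic function $R:\Omega\to\mathbb{M}_{n-d}$ such that \[F(z)=U\begin{bmatrix}\|F(z_0)\|\cdot I_d & 0\\ 0 & R(z)\end{bmatrix}V\quad\text{for all }z\in\Omega.\] In particular, whenever $x\in\mathbb{C}^n$ satisfies $\|F(z_0)x\|=\|F(z_0)\|\cdot\|x\|$, the map $z\mapsto F(z)x$ is constant on $\Omega$ and $F^{(k)}(z_0)x=0$ for all $k\geq1$.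
   Context: A region is a nonempty open connected subset of $\mathbb{C}$. $\mathbb{M}_n$ is the set of $n\times n$ complex matrices; $F$ is analytic if each entry is analytic, and $F^{(k)}$ denotes its $k$th derivative. $\|x\|$ is the Euclidean norm on $\mathbb{C}^n$ and $\|T\|$ the induced operator norm. $I_d$ is the $d\times d$ identity matrix. A matrix $A$ is unitary if $A^*A=AA^*=I$. *)

(* Defs.v *)
From mathcomp Require Import all_boot all_order all_algebra.
From mathcomp Require Import complex.
From mathcomp Require Import all_classical all_reals all_analysis.
Set Implicit Arguments. Unset Strict Implicit. Unset Printing Implicit Defensive.
Import Order.TTheory GRing.Theory Num.Theory.
Import numFieldNormedType.Exports.
Local Open Scope ring_scope.
Local Open Scope classical_set_scope.

Section Defs.
Variable R : realType.

Definition region (Om : set (R[i])^o) : Prop :=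
  [/\ Om !=set0, open Om & connected Om].

Definition analytic_on (Om : set (R[i])^o) (f : (R[i])^o -> (R[i])^o) : Prop :=
  forall z, Om z -> derivable f z 1.

Definition mx_analytic_on (m : nat) (Om : set (R[i])^o)
  (F : R[i] -> 'M[R[i]]_m) : Prop :=
  forall i j, analytic_on Om (fun z : (R[i])^o => (F z i j : (R[i])^o)).

Definition mxderive (m : nat) (k : nat) (F : R[i] -> 'M[R[i]]_m) (z : R[i])
  : 'M[R[i]]_m :=
  \matrix_(i, j) (derive1n k (fun w : (R[i])^o => (F w i j : (R[i])^o)) z : R[i]).

Definition vnorm (m : nat) (x : 'cV[R[i]]_m) : R :=
  Num.sqrt (\sum_i ((complex.Re (x i 0)) ^+ 2 + (complex.Im (x i 0)) ^+ 2)).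

Definition opnorm (m : nat) (A : 'M[R[i]]_m) : R :=
  sup [set vnorm (A *m x) | x in [set x : 'cV[R[i]]_m | vnorm x <= 1]].

Definition mxstar (m : nat) (A : 'M[R[i]]_m) : 'M[R[i]]_m :=
  map_mx (@conjc R) A^T.

Definition unitary (m : nat) (A : 'M[R[i]]_m) : Prop :=
  mxstar A *m A = 1%:M /\ A *m mxstar A = 1%:M.

(* S is a linear subspace of C^m of dimension d: it is exactly the span of
   the d linearly independent rows of some B (transposed into columns). *)
Definition has_dim (m : nat) (S : set 'cV[R[i]]_m) (d : nat) : Prop :=
  exists B : 'M[R[i]]_(d, m),
    row_free B /\ forall x : 'cV[R[i]]_m, S x <-> (x^T <= B)%MS.

(* block diagonal matrix diag(c I_d, M) of size m (meaningful for d <= m) *)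
Definition blkdiag (m d : nat) (c : R[i]) (M : 'M[R[i]]_(m - d)) : 'M[R[i]]_m :=
  conform_mx 0 (block_mx (c%:M : 'M[R[i]]_d) 0 0 M).

Definition cR (r : R) : R[i] := Complex r 0.

End Defs.

(* Main.v *)
(** For a maximizing vector [x], the scalar function
    [f z = <F z x, F z0 x>] is holomorphic and attains the maximum of its modulus
    at [z0], where its value is [|F z0 x|^2]. The maximum principle makes it
    constant, and equality in [|f z| <= |F z x| |F z0 x|] forces
    [F z x = F z0 x]. Moreover [M^2 |y|^2 - |F z y|^2], with [M = |F z0|], is a
    nonnegative Hermitian form that vanishes at the maximizing vectors, so [F z]
    maps their orthogonal complement to the orthogonal complement of their image;
    completing orthonormal bases gives the block form.

    Holomorphy is mere complex differentiability. Contour integrals over squares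
    are replaced by generalized (ultrafilter) limits of midpoint sums, which need
    only boundedness of the integrand. Goursat's bisection, with one exceptional
    point, gives [f w * Lam (1 / (z - w)) = Lam (f z / (z - w))] for a bounded
    linear functional [Lam]. From this formula follow the differentiability of
    the derivative, and an equicontinuity estimate for bounded holomorphic
    functions which, through a Schwarz-Pick argument, yields the maximum
    principle. *)

Require Import Defs.
From mathcomp Require Import all_boot all_order all_algebra.
From mathcomp Require Import complex sesquilinear spectral.
From mathcomp Require Import all_classical all_reals all_analysis.
From mathcomp Require Import ring lra.
Set Implicit Arguments. Unset Strict Implicit. Unset Printing Implicit Defensive.
Import Order.TTheory GRing.Theory Num.Theory.
Import numFieldNormedType.Exports.
Local Open Scope ring_scope.
Local Open Scope classical_set_scope.

(** * The modulus and complex differentiability *)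

Section Modulus.
Variable R : realType.
Local Notation C := R[i].
Implicit Types (z w h : C).

Definition cabs z : R := Normc.normc z.

Lemma normrE z : `|z| = (cabs z)%:C%C.
Proof. by []. Qed.

Lemma cabsM z w : cabs (z * w) = cabs z * cabs w.
Proof. exact: Normc.normcM. Qed.

Lemma cabsV z : cabs z^-1 = (cabs z)^-1.
Proof. exact: Normc.normcV. Qed.

Lemma cabs0 : cabs 0 = 0.
Proof. exact: Normc.normc0. Qed.

Lemma cabs1 : cabs 1 = 1.
Proof. exact: Normc.normc1. Qed.

Lemma cabsN z : cabs (- z) = cabs z.
Proof. exact: (@normcN R z). Qed.

Lemma cabsD z w : cabs (z + w) <= cabs z + cabs w.
Proof. exact: (@le_normcD R z w). Qed.

Lemma cabsB z w : cabs (z - w) <= cabs z + cabs w.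
Proof. by rewrite -(cabsN w) cabsD. Qed.

Lemma cabs_distC z w : cabs (z - w) = cabs (w - z).
Proof. by rewrite -cabsN opprB. Qed.

Lemma cabs_ge0 z : 0 <= cabs z.
Proof. by rewrite -lecR -normrE; exact: normr_ge0. Qed.

Lemma cabs_eq0 z : (cabs z == 0) = (z == 0).
Proof.
by apply/eqP/eqP => [/Normc.eq0_normc//|->]; rewrite cabs0.
Qed.

Lemma cabs_gt0 z : (0 < cabs z) = (z != 0).
Proof. by rewrite lt_neqAle cabs_ge0 andbT eq_sym cabs_eq0. Qed.

Lemma cabsX z n : cabs (z ^+ n) = cabs z ^+ n.
Proof. by elim: n => [|n IH]; rewrite ?expr0 ?cabs1// !exprS cabsM IH. Qed.

Lemma cabs_real (x : R) : cabs x%:C%C = `|x|.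
Proof. by rewrite /cabs /= expr0n /= addr0 sqrtr_sqr. Qed.

Lemma cabs_nat n : cabs n%:R = n%:R.
Proof.
have -> : (n%:R : C) = (n%:R : R)%:C%C by rewrite rmorph_nat.
by rewrite cabs_real normr_nat.
Qed.

Lemma cabs_sqr z : cabs z ^+ 2 = complex.Re z ^+ 2 + complex.Im z ^+ 2.
Proof. by case: z => a b; rewrite /cabs /= sqr_sqrtr // addr_ge0 ?sqr_ge0. Qed.

Lemma Re_le_cabs z : `|complex.Re z| <= cabs z.
Proof.
rewrite -(@ler_pXn2r _ 2) ?nnegrE ?cabs_ge0// cabs_sqr real_normK ?num_real//.
by rewrite lerDl sqr_ge0.
Qed.

Lemma Im_le_cabs z : `|complex.Im z| <= cabs z.
Proof.
rewrite -(@ler_pXn2r _ 2) ?nnegrE ?cabs_ge0// cabs_sqr real_normK ?num_real//.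
by rewrite lerDr sqr_ge0.
Qed.

Lemma cabs_le_ReIm z : cabs z <= `|complex.Re z| + `|complex.Im z|.
Proof.
rewrite -(@ler_pXn2r _ 2) ?nnegrE ?cabs_ge0 ?addr_ge0// cabs_sqr.
rewrite -(real_normK (num_real (complex.Re z))).
rewrite -(real_normK (num_real (complex.Im z))).
by have := normr_ge0 (complex.Re z); have := normr_ge0 (complex.Im z); nra.
Qed.

Lemma cabs_sum (I : Type) (r : seq I) (F : I -> C) :
  cabs (\sum_(i <- r) F i) <= \sum_(i <- r) cabs (F i).
Proof.
elim: r => [|i r IH]; first by rewrite !big_nil cabs0.
by rewrite !big_cons (le_trans (cabsD _ _))// lerD2l.
Qed.

Lemma Re_sum (I : Type) (r : seq I) (F : I -> C) :
  complex.Re (\sum_(i <- r) F i) = \sum_(i <- r) complex.Re (F i).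
Proof.
elim: r => [|i r IH]; first by rewrite !big_nil.
by rewrite !big_cons -IH; case: (F i) (\sum_(j <- r) F j) => ? ? [].
Qed.

Lemma Im_sum (I : Type) (r : seq I) (F : I -> C) :
  complex.Im (\sum_(i <- r) F i) = \sum_(i <- r) complex.Im (F i).
Proof.
elim: r => [|i r IH]; first by rewrite !big_nil.
by rewrite !big_cons -IH; case: (F i) (\sum_(j <- r) F j) => ? ? [].
Qed.

(** Differentiability as a first-order expansion with real tolerances and no division, the form that
    the estimates on squares use. *)
Definition cdiff (f : C -> C) z l := forall e : R, 0 < e ->
  exists2 d : R, 0 < d &
    forall h, cabs h < d -> cabs (f (z + h) - f z - l * h) <= e * cabs h.

Lemma pos_complexP (e : C) : 0 < e -> exists2 r : R, 0 < r & e = r%:C%C.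
Proof.
move=> e0; have /complex_realP[r er] : e \is Num.real by rewrite gtr0_real.
by exists r => //; rewrite -ltcR -er.
Qed.

Lemma nbhs_cabsP (z : C^o) (A : set C^o) :
  nbhs z A <-> exists2 d : R, 0 < d & forall w, cabs (w - z) < d -> A w.
Proof.
split.
  move=> /nbhs_ballP[e /= /pos_complexP[r r0 ->] H]; exists r => // w wr.
  by apply: H; rewrite -ball_normE /= -normrN opprB normrE ltcR.
move=> [d d0 H]; apply/nbhs_ballP; exists (d%:C)%C => /=; first by rewrite ltcR.
by move=> w; rewrite -ball_normE /= -normrN opprB normrE ltcR => /H.
Qed.

Lemma is_derive_cdiff (f : C^o -> C^o) (z l : C^o) :
  is_derive z 1 f l <-> cdiff f z l.
Proof.
have scE (k h x : C) : h != 0 ->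
    cabs (k - h^-1 *: (x : C^o)) = cabs (x - k * h) / cabs h.
  move=> h0; rewrite -cabsV -cabsM -cabsN; congr cabs.
  by rewrite /GRing.scale /=; field.
split=> [[df <-]|H].
  move=> e e0; have /cvgrPdist_le/(_ (e%:C)%C) :
    h^-1 *: ((f \o shift z) (h *: (1 : C^o)) - f z) @[h --> (0 : C^o)^'] --> 'D_1 f z
    by exact: df.
  rewrite ltcR => /(_ e0).
  rewrite near_withinE => /nbhs_cabsP[d d0 Hd]; exists d => // h hd.
  have [->|h0] := eqVneq h 0.
    by rewrite addr0 subrr mulr0 subrr !cabs0 mulr0.
  have := Hd h; rewrite subr0 => /(_ hd h0); rewrite normrE lecR.
  rewrite scE// /= [h *: _]mulr1 (addrC h z).
  by rewrite ler_pdivrMr // cabs_gt0.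
have cvl : h^-1 *: ((f \o shift z) (h *: (1 : C^o)) - f z) @[h --> (0 : C^o)^'] --> l.
  apply/cvgrPdist_le => _ /pos_complexP[e e0 ->].
  rewrite near_withinE; apply/nbhs_cabsP.
  have [d d0 Hd] := H e e0; exists d => // h; rewrite subr0 => hd h0.
  rewrite normrE lecR scE// /= [h *: _]mulr1 (addrC h z).
  by rewrite ler_pdivrMr ?cabs_gt0// Hd.
by split; [exact: cvgP cvl | exact: cvg_lim cvl].
Qed.

End Modulus.
Arguments cabs {R} z : simpl never.

(** * Generalized limits *)

Section GeneralizedLimit.
Variable R : realType.

Definition ev_bounded (u : nat -> R) :=
  exists B n0, forall n, (n0 <= n)%N -> `|u n| <= B.

(** Limits along an ultrafilter that refines the eventual filter: a bounded sequence eventually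
    stays in a compact segment, where the image ultrafilter converges. *)
Lemma generalized_limit : exists L : (nat -> R) -> R,
  [/\ forall u v, ev_bounded u -> ev_bounded v ->
        L (fun n => u n + v n) = L u + L v,
      forall c u, ev_bounded u -> L (fun n => c * u n) = c * L u
    & forall u b n0, ev_bounded u ->
        (forall n, (n0 <= n)%N -> u n <= b) -> L u <= b].
Proof.
have [G [GU ooG]] := ultraFilterLemma (eventually_filter).
pose L (u : nat -> R) : R := lim (u @ G).
have cvL u : ev_bounded u -> u @ G --> L u.
  move=> [B [n0 uB]].
  have GB : (u @ G) `[-B, B].
    apply: ooG; exists n0 => // n /= n0n; rewrite /= in_itv /=.
    by rewrite -ler_norml uB.
  have [p [_ cp]] := segment_compact _ GB.
  suff up : u @ G --> p by move: (up) => /cvgP.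
  (* If the preimage of [V] were not in [G], its complement would be, and the cluster point [p]
     would make [V] meet its own complement. *)
  move=> V Vp; have [//|GV] := in_ultra_setVsetC (u @^-1` V) GU.
  have [q []] := cp (~` V) V GV Vp.
  by [].
exists L; split.
- move=> u v bu bv; apply: cvg_lim => //.
  exact: (cvgD (cvL _ bu) (cvL _ bv)).
- move=> c u bu; apply: cvg_lim => //.
  exact: (cvgM (cvg_cst c) (cvL _ bu)).
- move=> u b n0 bu ub.
  apply: (closed_cvg (fun x => x <= b) (@closed_le R b) _ _ (cvL _ bu)).
  by apply: ooG; exists n0.
Qed.

Definition glim : (nat -> R) -> R := projT1 (cid generalized_limit).

Lemma glimD u v : ev_bounded u -> ev_bounded v ->
  glim (fun n => u n + v n) = glim u + glim v.
Proof. by have [H _ _] := projT2 (cid generalized_limit); exact: H. Qed.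

Lemma glimZ c u : ev_bounded u -> glim (fun n => c * u n) = c * glim u.
Proof. by have [_ H _] := projT2 (cid generalized_limit); exact: H. Qed.

Lemma glim_le u b n0 : ev_bounded u ->
  (forall n, (n0 <= n)%N -> u n <= b) -> glim u <= b.
Proof. by have [_ _ H] := projT2 (cid generalized_limit); exact: H. Qed.

Lemma ev_boundedZ c u : ev_bounded u -> ev_bounded (fun n => c * u n).
Proof.
move=> [B [n0 H]]; exists (`|c| * B), n0 => n /H uB.
by rewrite normrM ler_wpM2l.
Qed.

Lemma glim_ge u b n0 : ev_bounded u ->
  (forall n, (n0 <= n)%N -> b <= u n) -> b <= glim u.
Proof.
move=> bu bB; rewrite -lerN2 -mulN1r -glimZ//.
by apply: (@glim_le _ _ n0); [exact: ev_boundedZ|] => n /bB; rewrite mulN1r lerN2.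
Qed.

Local Notation C := R[i].
Implicit Types (u v : nat -> C).

Definition cev_bounded u :=
  exists B n0, forall n, (n0 <= n)%N -> cabs (u n) <= B.

Definition clim u : C :=
  Complex (glim (fun n => complex.Re (u n))) (glim (fun n => complex.Im (u n))).

Lemma cev_bounded_Re u : cev_bounded u -> ev_bounded (fun n => complex.Re (u n)).
Proof.
by move=> [B [n0 H]]; exists B, n0 => n /H; apply: le_trans; exact: Re_le_cabs.
Qed.

Lemma cev_bounded_Im u : cev_bounded u -> ev_bounded (fun n => complex.Im (u n)).
Proof.
by move=> [B [n0 H]]; exists B, n0 => n /H; apply: le_trans; exact: Im_le_cabs.
Qed.

Lemma cev_boundedD u v : cev_bounded u -> cev_bounded v ->
  cev_bounded (fun n => u n + v n).
Proof.
move=> [B [n0 H]] [B' [n0' H']]; exists (B + B'), (maxn n0 n0') => n.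
by rewrite geq_max => /andP[/H ? /H' ?]; rewrite (le_trans (cabsD _ _))// lerD.
Qed.

Lemma climD u v : cev_bounded u -> cev_bounded v ->
  clim (fun n => u n + v n) = clim u + clim v.
Proof.
move=> bu bv; rewrite /clim /GRing.add /=; congr Complex.
  rewrite -glimD; [|exact: cev_bounded_Re|exact: cev_bounded_Re].
  by congr glim; apply/funext => n; case: (u n) (v n) => ? ? [].
rewrite -glimD; [|exact: cev_bounded_Im|exact: cev_bounded_Im].
by congr glim; apply/funext => n; case: (u n) (v n) => ? ? [].
Qed.

Lemma climZ c u : cev_bounded u -> clim (fun n => c * u n) = c * clim u.
Proof.
move=> bu; have bR := cev_bounded_Re bu; have bI := cev_bounded_Im bu.
case: c => a b; rewrite /clim /GRing.mul /=; congr Complex.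
  rewrite -mulNr -!glimZ// -glimD; [|exact: ev_boundedZ|exact: ev_boundedZ].
  by congr glim; apply/funext => n; case: (u n) => x y /=; rewrite mulNr.
rewrite -!glimZ// -glimD; [|exact: ev_boundedZ|exact: ev_boundedZ].
by congr glim; apply/funext => n; case: (u n) => x y /=.
Qed.

(** Real and imaginary parts are bounded separately, whence the factor 2, harmless below. *)
Lemma clim_le u B n0 : (forall n, (n0 <= n)%N -> cabs (u n) <= B) ->
  cabs (clim u) <= 2 * B.
Proof.
move=> uB; have bu : cev_bounded u by exists B, n0.
have bR := cev_bounded_Re bu; have bI := cev_bounded_Im bu.
rewrite (le_trans (cabs_le_ReIm _))//= mulr_natl mulr2n.
apply: lerD; rewrite ler_norml; apply/andP; split.
- apply: (glim_ge (n0 := n0)) => // n /uB; have := Re_le_cabs (u n).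
  by rewrite ler_norml; lra.
- apply: (glim_le (n0 := n0)) => // n /uB; have := Re_le_cabs (u n).
  by rewrite ler_norml; lra.
- apply: (glim_ge (n0 := n0)) => // n /uB; have := Im_le_cabs (u n).
  by rewrite ler_norml; lra.
- apply: (glim_le (n0 := n0)) => // n /uB; have := Im_le_cabs (u n).
  by rewrite ler_norml; lra.
Qed.

(** Only the tail counts: the difference is bounded by 0 from [n0] on. *)
Lemma eq_clim u v n0 : cev_bounded v ->
  (forall n, (n0 <= n)%N -> u n = v n) -> clim u = clim v.
Proof.
move=> bv uv.
have dn n : (n0 <= n)%N -> cabs (u n - v n) <= 0.
  by move=> /uv->; rewrite subrr cabs0.
have d0 : clim (fun n => u n - v n) = 0.
  apply/eqP; rewrite -cabs_eq0 eq_le cabs_ge0 andbT.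
  by rewrite (le_trans (clim_le dn))// mulr0.
rewrite -[RHS]add0r -d0 -climD//; last by exists 0, n0.
by congr clim; apply/funext => n; rewrite subrK.
Qed.

End GeneralizedLimit.
Arguments clim {R} u : simpl never.

(** * Contour sums over squares *)

Section Contour.
Variable R : realType.
Local Notation C := R[i].
Implicit Types (f g : C -> C) (x y l t h : R) (z w : C).

(** Combines the four sides of the square with lower left corner [x + iy] at one parameter [t]:
    bottom minus top, and [i] times right minus left, the counterclockwise orientation of [f dz]. *)
Definition cterm f x y l t : C :=
  f (Complex (x + t) y) - f (Complex (x + t) (y + l)) +
  'i%C * (f (Complex (x + l) (y + t)) - f (Complex x (y + t))).

(** Midpoint rule for the contour integral of [f] around the square of side [n h], with [n] nodes on
    each side. *)
Definition csum f x y h n : C :=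
  h%:C%C * \sum_(j < n) cterm f x y (n%:R * h) ((j%:R + 2^-1) * h).

(** All squares use the same mesh [h], so inner sides occur twice, at the same nodes and with
    opposite orientations, and cancel exactly. *)
Lemma csum_sub f x y h n : let l := n%:R * h in
  csum f x y h (n + n) = csum f x y h n + csum f (x + l) y h n +
    csum f x (y + l) h n + csum f (x + l) (y + l) h n.
Proof.
move=> l; rewrite /csum -!mulrDr; congr (_ * _).
rewrite big_split_ord /= -!big_split /=; apply: eq_bigr => j _.
have -> : (n + n)%:R * h = l + l by rewrite natrD mulrDl.
have -> : ((n + j)%:R + 2^-1) * h = l + (j%:R + 2^-1) * h.
  by rewrite natrD -addrA mulrDl.
by rewrite /cterm !addrA; ring.
Qed.

Definition in_square x y l z :=
  x <= complex.Re z <= x + l /\ y <= complex.Im z <= y + l.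

Definition on_square x y l z := in_square x y l z /\
  (complex.Re z = x \/ complex.Re z = x + l \/
   complex.Im z = y \/ complex.Im z = y + l).

Lemma cabs_i : cabs ('i%C : C) = 1.
Proof. by rewrite /cabs /= expr0n expr1n add0r sqrtr1. Qed.

Lemma cterm_le f x y l t B : 0 <= t <= l ->
  (forall z, on_square x y l z -> cabs (f z) <= B) ->
  cabs (cterm f x y l t) <= 4 * B.
Proof.
move=> /andP[t0 tl] fB; rewrite /cterm.
have h1 : cabs (f (Complex (x + t) y)) <= B.
  by apply: fB; split; [split=> /=; apply/andP; lra | right; right; left].
have h2 : cabs (f (Complex (x + t) (y + l))) <= B.
  by apply: fB; split; [split=> /=; apply/andP; lra | right; right; right].
have h3 : cabs (f (Complex (x + l) (y + t))) <= B.
  by apply: fB; split; [split=> /=; apply/andP; lra | right; left].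
have h4 : cabs (f (Complex x (y + t))) <= B.
  by apply: fB; split; [split=> /=; apply/andP; lra | left].
rewrite (le_trans (cabsD _ _))// cabsM cabs_i mul1r.
set p := f _ in h1 *; set q := f _ in h2 *.
set p' := f _ in h3 *; set q' := f _ in h4 *.
by have := cabsB p q; have := cabsB p' q'; lra.
Qed.

Lemma csum_le f x y h n B : 0 <= h ->
  (forall z, on_square x y (n%:R * h) z -> cabs (f z) <= B) ->
  cabs (csum f x y h n) <= 4 * (n%:R * h) * B.
Proof.
move=> h0 fB; rewrite /csum cabsM cabs_real ger0_norm//.
have -> : 4 * (n%:R * h) * B = h * \sum_(j < n) (4 * B).
  by rewrite sumr_const card_ord -[in RHS]mulr_natr; ring.
apply: ler_wpM2l => //; apply: le_trans (cabs_sum _ _) _.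
apply: ler_sum => j _; apply: cterm_le => //; apply/andP; split.
  by rewrite mulr_ge0// addr_ge0// invr_ge0.
apply: ler_wpM2r => //.
have : (j.+1%:R : R) <= n%:R by rewrite ler_nat.
by rewrite -natr1; lra.
Qed.

Lemma csumD f g x y h n :
  csum (fun z => f z + g z) x y h n = csum f x y h n + csum g x y h n.
Proof.
rewrite /csum -mulrDr -big_split /=; congr (_ * _); apply: eq_bigr => j _.
by rewrite /cterm; ring.
Qed.

Lemma csumZ c f x y h n : csum (fun z => c * f z) x y h n = c * csum f x y h n.
Proof.
rewrite /csum mulrCA; congr (_ * _); rewrite mulr_sumr; apply: eq_bigr => j _.
by rewrite /cterm; ring.
Qed.

(** The cancellation occurs node by node, with no limit: opposite nodes differ by [-il] and [l], and
    [-il + il = 0]. *)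
Lemma csum_affine (a b : C) x y h n : csum (fun z => a + b * z) x y h n = 0.
Proof.
rewrite /csum big1 ?mulr0// => j _; rewrite /cterm.
set l := _ * h; set t := _ * h.
set p := Complex (x + t) y; set q := Complex (x + t) (y + l).
set p' := Complex (x + l) (y + t); set q' := Complex x (y + t).
have pq : p - q + 'i%C * (p' - q') = 0.
  by apply/eqP; rewrite eq_complex /=; apply/andP; split; apply/eqP; ring.
by rewrite -(mulr0 b) -pq; ring.
Qed.

Variable s : R.
Hypothesis s_gt0 : 0 < s.

Definition side k : R := s / 2 ^+ k.

(** At stage [N] every square of generation [k] gets the mesh [side N], so subdivision is exact
    before the limit. The truncated [N - k] is meaningful from [N = k] on, and [clim] ignores the
    earlier terms. *)
Definition cint f x y k : C := clim (fun N => csum f x y (side N) (2 ^ (N - k))).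

Lemma side_gt0 k : 0 < side k.
Proof. by rewrite divr_gt0// exprn_gt0. Qed.

Lemma side0 : side 0 = s.
Proof. by rewrite /side expr0 divr1. Qed.

Lemma sideS k : side k = side k.+1 + side k.+1.
Proof. by rewrite /side exprS; field; rewrite expf_neq0. Qed.

Lemma side_steps k N : (k <= N)%N -> (2 ^ (N - k))%:R * side N = side k.
Proof.
move=> kN; rewrite /side natrX -{2}(subnKC kN) exprD.
by field; rewrite !expf_neq0.
Qed.

Lemma side_small (d : R) : 0 < d -> exists k, side k < d.
Proof.
move=> d0; pose k := Num.bound (s / d).
have kP : s / d < k%:R by rewrite archi_boundP// divr_ge0// ltW.
exists k; rewrite /side ltr_pdivrMr ?exprn_gt0// mulrC -ltr_pdivrMr//.
by rewrite (lt_le_trans kP)// -natrX ler_nat ltnW// ltn_expl.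
Qed.

Definition bounded_on f x y k :=
  exists B, forall z, on_square x y (side k) z -> cabs (f z) <= B.

Lemma csum_side_le f x y k B :
  (forall z, on_square x y (side k) z -> cabs (f z) <= B) ->
  forall N, (k <= N)%N ->
  cabs (csum f x y (side N) (2 ^ (N - k))) <= 4 * side k * B.
Proof.
move=> fB N kN; rewrite -(side_steps kN); apply: csum_le.
  exact/ltW/side_gt0.
by rewrite side_steps.
Qed.

Lemma cev_bounded_csum f x y k : bounded_on f x y k ->
  cev_bounded (fun N => csum f x y (side N) (2 ^ (N - k))).
Proof.
by move=> [B fB]; exists (4 * side k * B), k; exact: csum_side_le.
Qed.

Lemma cint_le f x y k B :
  (forall z, on_square x y (side k) z -> cabs (f z) <= B) ->
  cabs (cint f x y k) <= 8 * side k * B.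
Proof.
move=> fB; have := clim_le (csum_side_le fB).
by rewrite (_ : 2 * (4 * side k * B) = 8 * side k * B)//; ring.
Qed.

Lemma cintD f g x y k : bounded_on f x y k -> bounded_on g x y k ->
  cint (fun z => f z + g z) x y k = cint f x y k + cint g x y k.
Proof.
move=> bf bg; rewrite /cint -climD; [|exact: cev_bounded_csum..].
by congr clim; apply/funext => N; rewrite csumD.
Qed.

Lemma cintZ c f x y k : bounded_on f x y k ->
  cint (fun z => c * f z) x y k = c * cint f x y k.
Proof.
move=> bf; rewrite /cint -climZ; last exact: cev_bounded_csum.
by congr clim; apply/funext => N; rewrite csumZ.
Qed.

Lemma cint_affine (a b : C) x y k : cint (fun z => a + b * z) x y k = 0.
Proof.
apply/eqP; rewrite -cabs_eq0 eq_le cabs_ge0 andbT -(mulr0 2).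
by apply: (clim_le (n0 := 0)) => n _; rewrite csum_affine cabs0.
Qed.

Lemma cint_sub f x y k B :
  (forall z, in_square x y (side k) z -> cabs (f z) <= B) ->
  let l := side k.+1 in
  cint f x y k = cint f x y k.+1 + cint f (x + l) y k.+1 +
    cint f x (y + l) k.+1 + cint f (x + l) (y + l) k.+1.
Proof.
move=> fB l; have l0 := side_gt0 k.+1.
have bd x' y' : x <= x' <= x + l -> y <= y' <= y + l -> bounded_on f x' y' k.+1.
  rewrite /l => /andP[? ?] /andP[? ?]; exists B => z [[/andP[? ?] /andP[? ?]] _].
  apply: fB; rewrite /in_square sideS.
  by split; apply/andP; lra.
have [b1 b2 b3 b4] : [/\ bounded_on f x y k.+1, bounded_on f (x + l) y k.+1,
    bounded_on f x (y + l) k.+1 & bounded_on f (x + l) (y + l) k.+1].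
  by split; apply: bd; rewrite /l; apply/andP; lra.
have cb := cev_bounded_csum.
have c12 := cev_boundedD (cb _ _ _ _ b1) (cb _ _ _ _ b2).
have c123 := cev_boundedD c12 (cb _ _ _ _ b3).
rewrite /cint -(climD (cb _ _ _ _ b1) (cb _ _ _ _ b2)).
rewrite -(climD c12 (cb _ _ _ _ b3)) -(climD c123 (cb _ _ _ _ b4)).
(* From [N = k + 1] on, a side of the square has twice as many nodes as a side of a quarter. *)
apply: (@eq_clim _ _ _ k.+1); first exact: cev_boundedD c123 (cb _ _ _ _ b4).
move=> N kN; have -> : (2 ^ (N - k) = 2 ^ (N - k.+1) + 2 ^ (N - k.+1))%N.
  by rewrite addnn -mul2n -expnS subnSK.
by rewrite csum_sub side_steps.
Qed.

End Contour.

(** * Goursat's lemma *)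

Section Goursat.
Variable R : realType.
Local Notation C := R[i].
Implicit Types (f g : C -> C) (x y l t h : R) (z w : C).

Lemma nested_intervals (a b : nat -> R) :
  (forall k, a k <= a k.+1) -> (forall k, b k.+1 <= b k) ->
  (forall k, a k <= b k) -> exists c, forall k, a k <= c <= b k.
Proof.
move=> aS bS ab.
have amono k m : (k <= m)%N -> a k <= a m.
  move=> /subnKC <-; elim: (m - k)%N => [|i IH]; first by rewrite addn0.
  by rewrite addnS (le_trans IH).
have bmono k m : (k <= m)%N -> b m <= b k.
  move=> /subnKC <-; elim: (m - k)%N => [|i IH]; first by rewrite addn0.
  by rewrite addnS (le_trans (bS _)).
have abkm k m : a k <= b m.
  have [km|/ltnW mk] := leqP k m; first exact: le_trans (amono _ _ km) (ab _).
  exact: le_trans (ab _) (bmono _ _ mk).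
exists (sup (range a)) => k; apply/andP; split.
  by apply: ub_le_sup; [exists (b 0) => _ [m _ <-] | exists k].
by apply: ge_sup; [exists (a 0), 0 | move=> _ [m _ <-]].
Qed.

Lemma in_square_dist x y l z w :
  in_square x y l z -> in_square x y l w -> cabs (z - w) <= 2 * l.
Proof.
case: z w => [a b] [a' b'] [/= /andP[? ?] /andP[? ?]] [/= /andP[? ?] /andP[? ?]].
rewrite (le_trans (cabs_le_ReIm _))//= mulr_natl mulr2n.
by apply: lerD; rewrite ler_norml; apply/andP; split; lra.
Qed.

(* Counts the two one-sided germs of [t] contained in [[x, x + l]]: unlike the
   indicator of the closed interval, it is additive under subdivision. *)
Definition germ_count x l t : R :=
  ((x <= t) && (t < x + l))%:R + ((x < t) && (t <= x + l))%:R.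

Lemma germ_count_sub x l t : 0 < l ->
  germ_count x (l + l) t = germ_count x l t + germ_count (x + l) l t.
Proof.
move=> l0; rewrite /germ_count !addrA.
case: (leP x t) => h1; case: (ltP t (x + l + l)) => h2; case: (ltP x t) => h3;
  case: (leP t (x + l + l)) => h4; case: (ltP t (x + l)) => h5;
  case: (leP t (x + l)) => h6; rewrite /=;
  try (rewrite ?(addr0, add0r); done); try lra.
Qed.

Lemma germ_count_ge0 x l t : 0 <= germ_count x l t.
Proof. by rewrite addr_ge0// ler0n. Qed.

Lemma germ_count_le2 x l t : germ_count x l t <= 2.
Proof. by rewrite /germ_count; do 2!case: (_ && _) => /=; lra. Qed.

Lemma germ_count_ge1 x l t : 0 < l -> x <= t <= x + l -> 1 <= germ_count x l t.
Proof.
move=> l0 /andP[xt tl]; rewrite /germ_count xt tl andbT /=.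
by case: (ltP t (x + l)) => h; case: (ltP x t) => h'; rewrite /=; lra.
Qed.

(** Counts the quadrant germs at [w] contained in the square: additive under division into quarters,
    at most 4, and at least 1 as soon as the closed square contains [w]. *)
Definition germ_mass x y l w : R :=
  germ_count x l (complex.Re w) * germ_count y l (complex.Im w).

Variable s : R.
Hypothesis s_gt0 : 0 < s.
Local Notation side := (side s).
Local Notation cint := (cint s).

(* Bisection: a lower bound [e * (area + germ_mass w)] on the contour sum passes
   to a subsquare. The nested squares shrink to a point, which contradicts
   differentiability off [w] and boundedness at [w]. *)
Lemma goursat f x y w B :
  (forall z, in_square x y s z -> cabs (f z) <= B) ->
  (forall z, in_square x y s z -> z != w -> exists l : C, cdiff f z l) ->
  cint f x y 0 = 0.
Proof.
move=> fB fd; apply/eqP; rewrite -cabs_eq0; apply/negPn/negP => J0.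
have {J0}J0 : 0 < cabs (cint f x y 0) by rewrite lt_neqAle eq_sym J0 cabs_ge0.
have B0 : 0 <= B.
  apply: le_trans (cabs_ge0 (f (Complex x y))) _; apply: fB.
  by split=> /=; apply/andP; have := s_gt0; split; lra.
(* [D] bounds area plus mass of the initial square; the factor 2 in [e] then makes the initial
   inequality strict. *)
pose D := s ^+ 2 + 4; have D0 : 0 < D by rewrite ltr_wpDl// sqr_ge0.
pose e := cabs (cint f x y 0) / (2 * D).
have e0 : 0 < e by rewrite divr_gt0// mulr_gt0.
pose P k (q : R * R) := [/\ x <= q.1, q.1 + side k <= x + s, y <= q.2,
  q.2 + side k <= y + s &
  e * (side k ^+ 2 + germ_mass q.1 q.2 (side k) w) < cabs (cint f q.1 q.2 k)].
pose Q k (q q' : R * R) := [/\ q.1 <= q'.1, q'.1 + side k.+1 <= q.1 + side k,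
  q.2 <= q'.2 & q'.2 + side k.+1 <= q.2 + side k].
have step k q : P k q -> exists q', P k.+1 q' /\ Q k q q'.
  move=> [x1 x2 y1 y2 Pq]; pose l := side k.+1.
  have lE : side k = l + l by rewrite sideS.
  have l0 : 0 < l by exact: side_gt0.
  have fBk z : in_square q.1 q.2 (side k) z -> cabs (f z) <= B.
    move=> [/andP[? ?] /andP[? ?]]; apply: fB.
    by rewrite /in_square; split; apply/andP; split; lra.
  have := cint_sub s_gt0 fBk; rewrite -/l /=.
  set j1 := cint f q.1 q.2 k.+1; set j2 := cint f (q.1 + l) q.2 k.+1.
  set j3 := cint f q.1 (q.2 + l) k.+1; set j4 := cint f (q.1 + l) (q.2 + l) k.+1.
  move=> jE.
  have jle : cabs (cint f q.1 q.2 k) <= cabs j1 + cabs j2 + cabs j3 + cabs j4.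
    rewrite jE (le_trans (cabsD _ _))// lerD2r (le_trans (cabsD _ _))// lerD2r.
    exact: cabsD.
  pose m q1 q2 := e * (l ^+ 2 + germ_mass q1 q2 l w).
  have mE : e * (side k ^+ 2 + germ_mass q.1 q.2 (side k) w) =
      m q.1 q.2 + m (q.1 + l) q.2 + m q.1 (q.2 + l) + m (q.1 + l) (q.2 + l).
    by rewrite lE /m /germ_mass !germ_count_sub//; ring.
  rewrite mE in Pq; rewrite lE in x2 y2.
  have good q1 q2 : (q1 = q.1 \/ q1 = q.1 + l) -> (q2 = q.2 \/ q2 = q.2 + l) ->
      m q1 q2 < cabs (cint f q1 q2 k.+1) -> exists q', P k.+1 q' /\ Q k q q'.
    move=> c1 c2 mq; exists (q1, q2); rewrite /P /Q /= lE -/l.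
    by case: c1 => e1; case: c2 => e2; subst q1 q2; split; split=> //; lra.
  have [h1|h1] := ltP (m q.1 q.2) (cabs j1); first by apply: good h1; left.
  have [h2|h2] := ltP (m (q.1 + l) q.2) (cabs j2).
    by apply: good h2; [right|left].
  have [h3|h3] := ltP (m q.1 (q.2 + l)) (cabs j3).
    by apply: good h3; [left|right].
  have [h4|h4] := ltP (m (q.1 + l) (q.2 + l)) (cabs j4).
    by apply: good h4; right.
  (* If all four quarters failed, summing would contradict the bound on the whole square, since area
     and mass are additive. *)
  by exfalso; lra.
have /choice[next nextP] : forall kq : nat * (R * R), exists q',
    P kq.1 kq.2 -> P kq.1.+1 q' /\ Q kq.1 kq.2 q'.
  move=> [k q] /=; have [/step[q' ?]|nP] := pselect (P k q); first by exists q'.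
  by exists q.
pose fix sq k := if k is k'.+1 then next (k', sq k') else (x, y).
have side0 := side0 s.
have P0 : P 0 (x, y).
  rewrite /P /= side0; split=> //.
  apply: (@le_lt_trans _ _ (e * D)).
    apply: ler_wpM2l; first exact: ltW.
    rewrite lerD2l /germ_mass (_ : 4 = 2 * 2); last by ring.
    by apply: ler_pM; rewrite ?germ_count_ge0 ?germ_count_le2.
  rewrite /e; have -> : cabs (cint f x y 0) / (2 * D) * D = cabs (cint f x y 0) / 2.
    by field; rewrite gt_eqF.
  by lra.
have Pk k : P k (sq k).
  by elim: k => [//|k IH]; have [] := nextP (k, sq k) IH.
have Qk k : Q k (sq k) (sq k.+1) by have [] := nextP (k, sq k) (Pk k).
have [cx cxP] : exists c, forall k, (sq k).1 <= c <= (sq k).1 + side k.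
  apply: nested_intervals => k; first by have [] := Qk k.
    by have [] := Qk k.
  by rewrite lerDl ltW// side_gt0.
have [cy cyP] : exists c, forall k, (sq k).2 <= c <= (sq k).2 + side k.
  apply: nested_intervals => k; first by have [] := Qk k.
    by have [] := Qk k.
  by rewrite lerDl ltW// side_gt0.
pose c := Complex cx cy.
have cin : in_square x y s c.
  by rewrite -side0; split=> /=; [exact: (cxP 0) | exact: (cyP 0)].
have bnd k : exists B', forall z,
    on_square (sq k).1 (sq k).2 (side k) z -> cabs (f z) <= B'.
  have [? ? ? ? _] := Pk k.
  exists B => z [[/andP[? ?] /andP[? ?]] _]; apply: fB.
  by rewrite /in_square; split; apply/andP; split; lra.
(* If the squares shrink to [w], all of them have mass at least 1, so the integrals stay above [e],
   whereas boundedness makes them at most [8 * side k * B], which tends to 0. *)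
have [cw|cw] := eqVneq c w.
  have [k kP] : exists k, side k < e / (8 * (B + 1)).
    by apply: side_small => //; rewrite divr_gt0// mulr_gt0//; lra.
  have [? ? ? ? Pe] := Pk k.
  have sk0 := side_gt0 s_gt0 k.
  have Jle : cabs (cint f (sq k).1 (sq k).2 k) <= 8 * side k * B.
    apply: cint_le => // z [[/andP[? ?] /andP[? ?]] _]; apply: fB.
    by rewrite /in_square; split; apply/andP; split; lra.
  have m1 : 1 <= germ_mass (sq k).1 (sq k).2 (side k) w.
    rewrite -[1]mulr1 /germ_mass -cw; apply: ler_pM => //.
      exact: germ_count_ge1.
    exact: germ_count_ge1.
  have : side k * (8 * (B + 1)) < e by rewrite -ltr_pdivlMr// mulr_gt0//; lra.
  have : e * 1 <= e * (side k ^+ 2 + germ_mass (sq k).1 (sq k).2 (side k) w).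
    by rewrite ler_pM2l//; have := sqr_ge0 (side k); lra.
  by nra.
have [l dl] := fd c cin cw.
(* The constant 32 turns the final bound [8 * side k * (e / 32 * (2 * side k))] into half of
   [e * side k ^+ 2]. *)
have e32 : 0 < e / 32 by rewrite divr_gt0.
have [d d0 dP] := dl _ e32.
have [k kP] : exists k, side k < d / 2 by apply: side_small => //; lra.
have [? ? ? ? Pe] := Pk k.
have sk0 := side_gt0 s_gt0 k.
(* [g] is [f] minus its first-order expansion at [c]; the affine part has integral 0. *)
pose g z := f z + (l * c - f c + - l * z).
have cin_k : in_square (sq k).1 (sq k).2 (side k) c by split; rewrite /=.
have gE : cint g (sq k).1 (sq k).2 k = cint f (sq k).1 (sq k).2 k.
  rewrite cintD//; first by rewrite cint_affine addr0.
  exists (cabs (l * c - f c) + cabs l * (cabs c + 2 * side k)) => z [zin _].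
  rewrite (le_trans (cabsD _ _))// lerD2l cabsM cabsN ler_wpM2l ?cabs_ge0//.
  have := cabsD c (z - c); rewrite addrCA subrr addr0 => h.
  by apply: (le_trans h); rewrite lerD2l; exact: in_square_dist zin cin_k.
have Jle : cabs (cint g (sq k).1 (sq k).2 k) <=
    8 * side k * (e / 32 * (2 * side k)).
  apply: cint_le => // z [zin _]; have zc := in_square_dist zin cin_k.
  have := dP (z - c); rewrite addrCA subrr addr0.
  have -> : f z - f c - l * (z - c) = g z by rewrite /g; ring.
  move=> /(_ ltac:(lra)) h; apply: (le_trans h).
  by rewrite ler_pM2l.
rewrite gE in Jle.
have m0 : 0 <= germ_mass (sq k).1 (sq k).2 (side k) w.
  by rewrite mulr_ge0// germ_count_ge0.
have : e * side k ^+ 2 <= e * (side k ^+ 2 + germ_mass (sq k).1 (sq k).2 (side k) w).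
  by rewrite ler_pM2l//; lra.
have : 0 < e * side k ^+ 2 by rewrite mulr_gt0// exprn_gt0.
by lra.
Qed.

End Goursat.

(** * The Cauchy functional *)

Section CauchyFunctional.
Variable R : realType.
Local Notation C := R[i].
Implicit Types (f g : C -> C) (z w a : C) (r : R).

(** Contains the boundary of the square with centre [a] and side [2 r]; later arguments see only
    this annulus and the disc of radius [2 r]. *)
Definition annulus a r z := r <= cabs (z - a) <= 2 * r.

Definition bounded_annulus a r f :=
  exists B, forall z, annulus a r z -> cabs (f z) <= B.

Lemma square_in_disc a r z : 0 < r ->
  in_square (complex.Re a - r) (complex.Im a - r) (2 * r) z ->
  cabs (z - a) <= 2 * r.
Proof.
case: z a => [x y] [a1 a2] r0 [/= /andP[? ?] /andP[? ?]].
rewrite -(@ler_pXn2r _ 2) ?nnegrE ?cabs_ge0//; last by rewrite mulr_ge0// ltW.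
rewrite cabs_sqr /=.
have : (x - a1) ^+ 2 <= r ^+ 2.
  by nra.
have : (y - a2) ^+ 2 <= r ^+ 2.
  by nra.
have : 0 <= r ^+ 2 by rewrite sqr_ge0.
by rewrite exprMn; lra.
Qed.

Lemma square_boundary_in_annulus a r z : 0 < r ->
  on_square (complex.Re a - r) (complex.Im a - r) (2 * r) z -> annulus a r z.
Proof.
move=> r0 [zin zon]; apply/andP; split; last exact: square_in_disc.
have hR := Re_le_cabs (z - a); have hI := Im_le_cabs (z - a).
move: zin zon hR hI; case: z a => [x y] [a1 a2] [/= /andP[? ?] /andP[? ?]] zon.
move=> hR hI.
case: zon => [e|[e|[e|e]]].
- by apply: le_trans hR; rewrite ler_normr e; apply/orP; right; lra.
- by apply: le_trans hR; rewrite ler_normr e; apply/orP; left; lra.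
- by apply: le_trans hI; rewrite ler_normr e; apply/orP; right; lra.
- by apply: le_trans hI; rewrite ler_normr e; apply/orP; left; lra.
Qed.

(** With [u = t - r] the term is [4 i r / (u^2 + r^2)], and [|u| <= r]. This lower bound stands in
    for the value [2 pi i] of the integral. *)
Lemma Im_cterm_inv (a1 a2 r t : R) : 0 < r -> 0 <= t <= 2 * r ->
  2 / r <= complex.Im (cterm (fun z => (z - Complex a1 a2)^-1)
             (a1 - r) (a2 - r) (2 * r) t).
Proof.
move=> r0 /andP[t0 tr]; rewrite /cterm; set u := t - r.
have e1 : Complex (a1 - r + t) (a2 - r) - Complex a1 a2 = Complex u (- r).
  by rewrite /u; apply/eqP; rewrite eq_complex /=; apply/andP; split; apply/eqP; ring.
have e2 : Complex (a1 - r + t) (a2 - r + 2 * r) - Complex a1 a2 = Complex u r.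
  by rewrite /u; apply/eqP; rewrite eq_complex /=; apply/andP; split; apply/eqP; ring.
have e3 : Complex (a1 - r + 2 * r) (a2 - r + t) - Complex a1 a2 = Complex r u.
  by rewrite /u; apply/eqP; rewrite eq_complex /=; apply/andP; split; apply/eqP; ring.
have e4 : Complex (a1 - r) (a2 - r + t) - Complex a1 a2 = Complex (- r) u.
  by rewrite /u; apply/eqP; rewrite eq_complex /=; apply/andP; split; apply/eqP; ring.
rewrite e1 e2 e3 e4 /= !sqrrN (addrC (r ^+ 2)).
set q := u ^+ 2 + r ^+ 2.
have q0 : 0 < q by rewrite ltr_wpDl ?sqr_ge0// exprn_gt0.
have -> : - (- r / q) - - (r / q) +
  (0 * (- (u / q) - - (u / q)) + 1 * (r / q - - r / q)) = 4 * r / q by field; lra.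
rewrite ler_pdivlMr// mulrAC ler_pdivrMr//.
have : u ^+ 2 <= r ^+ 2.
  by rewrite /u; nra.
by rewrite /q; nra.
Qed.

(** The properties of the contour integral that the sequel uses: linearity and a sup bound on the
    annulus, a nonzero value at the Cauchy kernel of the centre, and Cauchy's theorem with one
    exceptional point. *)
Definition is_cauchy_functional a r (Lam : (C -> C) -> C) :=
  [/\ forall f g, bounded_annulus a r f -> bounded_annulus a r g ->
        Lam (fun z => f z + g z) = Lam f + Lam g,
      forall c f, bounded_annulus a r f -> Lam (fun z => c * f z) = c * Lam f,
      forall f B, (forall z, annulus a r z -> cabs (f z) <= B) ->
        cabs (Lam f) <= 16 * r * B,
      Lam (fun z => (z - a)^-1) != 0
    & forall f w B, (forall z, cabs (z - a) <= 2 * r -> cabs (f z) <= B) ->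
        (forall z, cabs (z - a) <= 2 * r -> z != w -> exists l : C, cdiff f z l) ->
        Lam f = 0].

Lemma cauchy_functional a r : 0 < r -> exists Lam, is_cauchy_functional a r Lam.
Proof.
move=> r0; have s0 : 0 < 2 * r by rewrite mulr_gt0.
pose x := complex.Re a - r; pose y := complex.Im a - r.
have side0 := side0 (2 * r).
have bdd f : bounded_annulus a r f -> bounded_on (2 * r) f x y 0.
  by move=> [B fB]; exists B; rewrite side0 => z zon; apply: fB;
     exact: square_boundary_in_annulus.
exists (fun f => cint (2 * r) f x y 0); split.
- by move=> f g bf bg; rewrite cintD//; exact: bdd.
- by move=> c f bf; rewrite cintZ//; exact: bdd.
- move=> f B fB; have -> : 16 * r * B = 8 * side (2 * r) 0 * B by rewrite side0; ring.
  apply: cint_le => // z; rewrite side0 => zon; apply: fB.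
  exact: square_boundary_in_annulus.
- set f := (fun z => _).
  have bf : bounded_annulus a r f.
    exists r^-1 => z /andP[rz _]; rewrite /f cabsV lef_pV2// posrE//.
    exact: lt_le_trans rz.
  have cb := cev_bounded_csum s0 (bdd _ bf).
  (* Each midpoint sum has imaginary part at least [2 r * (2 / r) = 4], and so has the limit. *)
  suff : 4 <= complex.Im (cint (2 * r) f x y 0).
    by case: (cint _ _ _ _ _) => p q /= q4; rewrite eq_complex /=;
       apply/negP => /andP[_ /eqP q0]; move: q4; rewrite q0; lra.
  apply: (glim_ge (n0 := 0)); first exact: cev_bounded_Im.
  move=> n _; rewrite /csum side_steps// side0; set h := side _ n.
  have h0 : 0 < h by exact: side_gt0.
  have hn : (2 ^ (n - 0))%:R * h = 2 * r by rewrite /h side_steps// side0.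
  set m := (2 ^ (n - 0))%N in hn *.
  have ImZ (k : R) v : complex.Im (k%:C%C * v) = k * complex.Im v.
    by case: v => p q /=; ring.
  rewrite ImZ Im_sum.
  have -> : 4 = h * \sum_(j < m) (2 / r).
    by rewrite sumr_const card_ord -(mulr_natr (2 / r) m) mulrCA (mulrC h) hn; field; lra.
  apply: ler_wpM2l; first exact: ltW.
  apply: ler_sum => j _; rewrite /f /x /y; case: (a) => a1 a2.
  apply: Im_cterm_inv => //; rewrite -hn; apply/andP; split.
    by rewrite mulr_ge0// ?ltW// addr_gt0// ?invr_gt0//; rewrite ltr_wpDl// ler0n.
  apply: ler_wpM2r; first exact: ltW.
  have : (j.+1%:R : R) <= m%:R by rewrite ler_nat.
  by rewrite -natr1; lra.
- move=> f w B fB fd; apply: (goursat s0 (w := w) (B := B)) => z zin.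
    by apply: fB; exact: square_in_disc.
  by apply: fd; exact: square_in_disc.
Qed.

End CauchyFunctional.

(** * Cauchy's formula *)

Section CauchyFormula.
Variable R : realType.
Local Notation C := R[i].
Implicit Types (f g p : C -> C) (z w h : C).

Lemma cdiffP f z : derivable (f : C^o -> C^o) z 1 <-> exists l : C, cdiff f z l.
Proof.
split=> [df|[l /is_derive_cdiff[//]]].
by exists ('D_1 (f : C^o -> C^o) z); apply/is_derive_cdiff; exact: DeriveDef.
Qed.

Variables (a : C) (r : R).
Hypothesis r_gt0 : 0 < r.
Variable Lam : (C -> C) -> C.
Hypothesis LamP : is_cauchy_functional a r Lam.

Let LamD f g : bounded_annulus a r f -> bounded_annulus a r g ->
  Lam (fun z => f z + g z) = Lam f + Lam g.
Proof. by case: LamP => H _ _ _ _; exact: H. Qed.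

Let LamZ c f : bounded_annulus a r f -> Lam (fun z => c * f z) = c * Lam f.
Proof. by case: LamP => _ H _ _ _; exact: H. Qed.

Let Lam_le f B : (forall z, annulus a r z -> cabs (f z) <= B) ->
  cabs (Lam f) <= 16 * r * B.
Proof. by case: LamP => _ _ H _ _; exact: H. Qed.

(** The half radius keeps the kernel [1 / (z - w)] below [2 / r] on the annulus. *)
Definition inner w := cabs (w - a) < r / 2.

Lemma inner_center : inner a.
Proof. by rewrite /inner subrr cabs0 divr_gt0. Qed.

Lemma annulus_inner_dist z w : annulus a r z -> inner w -> r / 2 <= cabs (z - w).
Proof.
move=> /andP[rz _]; rewrite /inner => wa.
have : cabs (z - a) <= cabs (z - w) + cabs (w - a).
  by have := cabsD (z - w) (w - a); rewrite addrA subrK.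
by lra.
Qed.

Lemma annulus_inner_neq z w : annulus a r z -> inner w -> z - w != 0.
Proof.
by move=> za wi; rewrite -cabs_gt0 (lt_le_trans _ (annulus_inner_dist za wi))// divr_gt0.
Qed.

Lemma cauchy_kernel_le z w : annulus a r z -> inner w -> cabs (z - w)^-1 <= 2 / r.
Proof.
move=> za wi; have h := annulus_inner_dist za wi.
rewrite cabsV -[2 / r]invrK invf_div lef_pV2// posrE ?divr_gt0//.
by rewrite (lt_le_trans _ h)// divr_gt0.
Qed.

Lemma bounded_annulusM f g : bounded_annulus a r f -> bounded_annulus a r g ->
  bounded_annulus a r (fun z => f z * g z).
Proof.
move=> [B fB] [B' gB]; exists (B * B') => z za.
by rewrite cabsM ler_pM ?cabs_ge0// ?fB ?gB.
Qed.

Lemma bounded_annulus_cst (c : C) : bounded_annulus a r (fun=> c).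
Proof. by exists (cabs c). Qed.

Lemma bounded_annulus_kernel w n : inner w ->
  bounded_annulus a r (fun z => (z - w)^-1 ^+ n).
Proof.
move=> wi; exists ((2 / r) ^+ n) => z za; rewrite cabsX.
by rewrite lerXn2r ?nnegrE ?cabs_ge0 ?cauchy_kernel_le// ltW// divr_gt0.
Qed.

Definition cauchy_transform p n w := Lam (fun z => p z * (z - w)^-1 ^+ n).

(** [Lam] kills the difference quotient [(f z - f w) / (z - w)], which is bounded and, off [w],
    holomorphic. The transform of 1, in the role of [2 pi i], is never computed. *)
Lemma cauchy_formula f B w :
  (forall z, cabs (z - a) <= 2 * r -> cabs (f z) <= B) ->
  (forall z, cabs (z - a) <= 2 * r -> exists l : C, cdiff f z l) ->
  inner w -> f w * cauchy_transform (fun=> 1) 1 w = cauchy_transform f 1 w.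
Proof.
move=> fB fd wi.
have wa : cabs (w - a) <= 2 * r by move: wi; rewrite /inner; have := r_gt0; lra.
have B0 : 0 <= B := le_trans (cabs_ge0 _) (fB w wa).
pose g z := (f z - f w) * (z - w)^-1.
have bk := bounded_annulus_kernel 1 wi.
have bf : bounded_annulus a r f by exists B => z /andP[_]; exact: fB.
have gE : Lam g = cauchy_transform f 1 w - f w * cauchy_transform (fun=> 1) 1 w.
  rewrite /cauchy_transform -mulNr -LamZ; last first.
    by apply: bounded_annulusM => //; exact: bounded_annulus_cst.
  rewrite -LamD; last 2 first.
  - exact: bounded_annulusM.
  - apply: bounded_annulusM; first exact: bounded_annulus_cst.
    by apply: bounded_annulusM => //; exact: bounded_annulus_cst.
  by congr Lam; apply/funext => z; rewrite /g expr1; ring.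
have [l dl] := fd w wa.
have [d d0 dP] := dl 1 ltr01.
have g0 : Lam g = 0.
  (* Within [d] of [w] the quotient is at most [cabs l + 1] by differentiability, farther away at
     most [2 * B / d]; at [w] itself it is 0, as the inverse of 0 is 0. *)
  case: LamP => _ _ _ _ H; apply: (H _ w (cabs l + 1 + 2 * B / d)) => z za.
    have Bd : 0 <= 2 * B / d by rewrite divr_ge0 ?mulr_ge0// ltW.
    have [->|zw] := eqVneq z w.
      by rewrite /g !subrr mul0r cabs0; have := cabs_ge0 l; lra.
    have zw0 : 0 < cabs (z - w) by rewrite cabs_gt0 subr_eq0.
    rewrite /g cabsM cabsV ler_pdivrMr//.
    have [zd|zd] := ltP (cabs (z - w)) d.
      have := dP _ zd; rewrite addrCA subrr addr0 mul1r => h.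
      have := cabsD (f z - f w - l * (z - w)) (l * (z - w)).
      rewrite subrK cabsM; have := mulr_ge0 Bd (ltW zw0); nra.
    have h1 := cabsB (f z) (f w); have h2 := fB z za; have h3 := fB w wa.
    have h4 : 2 * B <= 2 * B / d * cabs (z - w).
      rewrite mulrAC ler_pdivlMr// ler_wpM2l// mulr_ge0//.
    have : 0 <= (cabs l + 1) * cabs (z - w).
      by rewrite mulr_ge0 ?cabs_ge0// addr_ge0// cabs_ge0.
    by lra.
  move=> zw; apply/cdiffP.
  apply: (@derivableM _ _ (fun z : C^o => f z - f w) (fun z : C^o => (z - w)^-1)).
    by apply: derivableB; [apply/cdiffP; exact: fd | exact: derivable_cst].
  apply: derivableV; first by rewrite subr_eq0.
  by apply: derivableB; [exact: derivable_id | exact: derivable_cst].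
by apply/eqP; rewrite eq_sym -subr_eq0 -gE g0.
Qed.

Lemma cauchy_transform_center : cauchy_transform (fun=> 1) 1 a != 0.
Proof.
rewrite /cauchy_transform.
have -> : (fun z : C => 1 * (z - a)^-1 ^+ 1) = (fun z => (z - a)^-1).
  by apply/funext => z; rewrite mul1r expr1.
by case: LamP.
Qed.

(** Differentiation under [Lam]: the remainder of the kernel is quadratic in [h], uniformly on the
    annulus, and [Lam] is bounded. *)
Lemma cdiff_kernel p (k k' : C -> C -> C) (M : R) w :
  bounded_annulus a r p ->
  (forall v, inner v -> bounded_annulus a r (k v)) ->
  bounded_annulus a r (k' w) -> inner w ->
  (forall h z, inner (w + h) -> annulus a r z ->
     cabs (k (w + h) z - k w z - h * k' w z) <= M * cabs h ^+ 2) ->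
  cdiff (fun v => Lam (fun z => p z * k v z)) w (Lam (fun z => p z * k' w z)).
Proof.
move=> [B pB] bk bk' wi kP e e0.
have bp : bounded_annulus a r p by exists B.
pose D := 16 * r * (`|B| * `|M|) + 1.
have D0 : 0 < D by rewrite ltr_wpDl// !mulr_ge0// ltW.
(* The first bound keeps [w + h] in the inner disc, the second makes [D * cabs h] less than [e]. *)
exists (Num.min (r / 2 - cabs (w - a)) (e / D)).
  by rewrite lt_min subr_gt0 divr_gt0// andbT.
move=> h; rewrite lt_min => /andP[h1 h2].
have hi : inner (w + h).
  by rewrite /inner -addrA (addrC h) addrA (le_lt_trans (cabsD _ _))//; lra.
have -> : Lam (fun z => p z * k (w + h) z) - Lam (fun z => p z * k w z) -
    Lam (fun z => p z * k' w z) * h =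
    Lam (fun z => p z * (k (w + h) z - k w z - h * k' w z)).
  have b1 := bounded_annulusM bp (bk _ hi).
  have b2 := bounded_annulusM bp (bk _ wi).
  have b3 := bounded_annulusM bp bk'.
  have b2' := bounded_annulusM (bounded_annulus_cst (-1)) b2.
  have b3' := bounded_annulusM (bounded_annulus_cst (- h)) b3.
  rewrite -mulN1r -LamZ// -LamD// mulrC -mulNr -LamZ// -LamD//.
    by congr Lam; apply/funext => z; ring.
  case: b1 b2' => [B1 H1] [B2 H2]; exists (B1 + B2) => z za.
  by rewrite (le_trans (cabsD _ _))// lerD ?H1 ?H2.
apply: (@le_trans _ _ (16 * r * (`|B| * (`|M| * cabs h ^+ 2)))).
  apply: Lam_le => z za; rewrite cabsM ler_pM ?cabs_ge0//.
    by rewrite (le_trans (pB _ za))// ler_norm.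
  rewrite (le_trans (kP _ _ hi za))// ler_wpM2r ?ler_norm//.
  by rewrite exprn_ge0// cabs_ge0.
have -> : 16 * r * (`|B| * (`|M| * cabs h ^+ 2)) = (D - 1) * cabs h * cabs h.
  by rewrite /D; ring.
apply: ler_wpM2r; first exact: cabs_ge0.
move: h2; rewrite ltr_pdivlMr// => h2.
by have := cabs_ge0 h; lra.
Qed.

Lemma cdiff_cauchy_transform1 p w : bounded_annulus a r p -> inner w ->
  cdiff (cauchy_transform p 1) w (cauchy_transform p 2 w).
Proof.
move=> bp wi.
apply: (@cdiff_kernel p (fun v z => (z - v)^-1 ^+ 1) (fun v z => (z - v)^-1 ^+ 2)
  ((2 / r) ^+ 3)) => //.
- by move=> v; exact: bounded_annulus_kernel.
- exact: bounded_annulus_kernel.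
move=> h z hi za.
have n1 := annulus_inner_neq za wi; have n2 := annulus_inner_neq za hi.
have -> : (z - (w + h))^-1 ^+ 1 - (z - w)^-1 ^+ 1 - h * (z - w)^-1 ^+ 2 =
    (z - w)^-1 ^+ 2 * (z - (w + h))^-1 * h ^+ 2.
  by field; rewrite n1 n2.
rewrite cabsM (cabsX h) ler_wpM2r ?exprn_ge0 ?cabs_ge0// (exprSr (2 / r)) cabsM cabsX.
by rewrite ler_pM ?exprn_ge0 ?cabs_ge0 ?cauchy_kernel_le// lerXn2r ?nnegrE
   ?cabs_ge0 ?cauchy_kernel_le// ltW// divr_gt0.
Qed.

Lemma cdiff_cauchy_transform2 p w : bounded_annulus a r p -> inner w ->
  exists l, cdiff (cauchy_transform p 2) w l.
Proof.
move=> bp wi; have q0 : 0 <= 2 / r by rewrite ltW// divr_gt0.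
exists (Lam (fun z => p z * (2 * (z - w)^-1 ^+ 3))).
apply: (@cdiff_kernel p (fun v z => (z - v)^-1 ^+ 2)
  (fun v z => 2 * (z - v)^-1 ^+ 3) (3 * (2 / r) ^+ 4)) => //.
- by move=> v; exact: bounded_annulus_kernel.
- apply: bounded_annulusM; first exact: bounded_annulus_cst.
  exact: bounded_annulus_kernel.
move=> h z hi za.
have n1 := annulus_inner_neq za wi; have n2 := annulus_inner_neq za hi.
have k1 := cauchy_kernel_le za wi; have k2 := cauchy_kernel_le za hi.
have -> : (z - (w + h))^-1 ^+ 2 - (z - w)^-1 ^+ 2 - h * (2 * (z - w)^-1 ^+ 3) =
    (2 * (z - w)^-1 + (z - (w + h))^-1) *
    ((z - w)^-1 ^+ 2 * (z - (w + h))^-1) * h ^+ 2.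
  by field; rewrite n1 n2.
rewrite cabsM (cabsX h) ler_wpM2r ?exprn_ge0 ?cabs_ge0//.
rewrite cabsM (_ : 3 * (2 / r) ^+ 4 = (3 * (2 / r)) * ((2 / r) ^+ 2 * (2 / r))); last first.
  by ring.
apply: ler_pM; rewrite ?cabs_ge0//.
  rewrite (le_trans (cabsD _ _))// cabsM cabs_nat; lra.
rewrite cabsM cabsX ler_pM ?exprn_ge0 ?cabs_ge0//.
by rewrite lerXn2r ?nnegrE ?cabs_ge0.
Qed.

End CauchyFormula.

(** * Holomorphic derivatives and the maximum principle *)

Section MaximumPrinciple.
Variable R : realType.
Local Notation C := R[i].
Implicit Types (f g : C -> C) (z w h a : C).

Lemma cdiff_lipschitz f z l : cdiff f z l -> exists2 d : R, 0 < d &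
  forall h, cabs h < d -> cabs (f (z + h) - f z) <= (cabs l + 1) * cabs h.
Proof.
move=> /(_ 1 ltr01)[d d0 H]; exists d => // h /H.
have := cabsD (f (z + h) - f z - l * h) (l * h).
by rewrite subrK cabsM; lra.
Qed.

(** Differentiability at the centre alone bounds [f] on a small disc; no compactness is involved. *)
Lemma local_bound f a (rho : R) : 0 < rho ->
  (forall z, cabs (z - a) < rho -> derivable (f : C^o -> C^o) z 1) ->
  exists r B, [/\ 0 < r, 2 * r < rho,
    forall z, cabs (z - a) <= 2 * r -> cabs (f z) <= B
    & forall z, cabs (z - a) <= 2 * r -> exists l : C, cdiff f z l].
Proof.
move=> rho0 fd; have /cdiffP[l /cdiff_lipschitz[d d0 H]] : derivable (f : C^o -> C^o) a 1.
  by apply: fd; rewrite subrr cabs0.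
pose m := Num.min rho d; have m0 : 0 < m by rewrite lt_min rho0 d0.
have [mr md] : m <= rho /\ m <= d by rewrite !ge_min !lexx orbT.
exists (m / 4), (cabs (f a) + (cabs l + 1) * m); split; first by lra.
- by lra.
- move=> z za; have := H (z - a); rewrite addrCA subrr addr0 => /(_ ltac:(lra)) h.
  have := cabsD (f z - f a) (f a); rewrite subrK.
  have : (cabs l + 1) * cabs (z - a) <= (cabs l + 1) * m.
    by apply: ler_wpM2l; [have := cabs_ge0 l | ]; lra.
  by lra.
- by move=> z za; apply/cdiffP/fd; lra.
Qed.

Lemma near_cabs_lt z (d : R) : 0 < d -> \forall w \near (z : C^o), cabs (w - z) < d.
Proof. by move=> d0; apply/nbhs_cabsP; exists d. Qed.

(** Differentiating Cauchy's formula near [a] expresses the derivative of [f] through [f] and the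
    transforms of orders 1 and 2, all differentiable at [a]. *)
Lemma derivable_derive1 (f : C^o -> C^o) (a : C) (rho : R) : 0 < rho ->
  (forall z, cabs (z - a) < rho -> derivable f z 1) ->
  derivable (f^`() : C^o -> C^o) a 1.
Proof.
move=> rho0 fd.
have [r [B [r0 rrho fB fcd]]] := local_bound rho0 fd.
have [Lam LamP] := cauchy_functional a r0.
pose K := cauchy_transform Lam.
have b1 : bounded_annulus a r (fun=> 1) by exact: bounded_annulus_cst.
have bf : bounded_annulus a r f by exists B => z /andP[_]; exact: fB.
have ia := inner_center a r0.
have Ka : K (fun=> 1) 1%N a != 0 := cauchy_transform_center LamP.
have [d d0 Hd] := cdiff_lipschitz (cdiff_cauchy_transform1 r0 LamP b1 ia).
set l := cabs _ + 1 in Hd.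
have l0 : 0 < l by rewrite ltr_wpDl// cabs_ge0.
(* Nonvanishing at the centre spreads to a neighbourhood through the Lipschitz bound. *)
have Kn0 : \forall w \near (a : C^o), K (fun=> 1) 1%N w != 0.
  near=> w.
  have wd : cabs (w - a) < Num.min d (cabs (K (fun=> 1) 1%N a) / l).
    near: w; apply: near_cabs_lt; rewrite lt_min d0 divr_gt0//.
    by rewrite cabs_gt0.
  move: wd; rewrite lt_min => /andP[w1 w2].
  apply/eqP => Kw; have := Hd _ w1.
  rewrite addrCA subrr addr0 -/(K _ _ w) -/(K _ _ a) Kw sub0r cabsN.
  by move: w2; rewrite ltr_pdivlMr//; lra.
have innernear w : inner a r w -> \forall v \near (w : C^o), inner a r v.
  move=> wi; have wi' : 0 < r / 2 - cabs (w - a) by rewrite subr_gt0.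
  near=> v; rewrite /inner.
  have : cabs (v - w) < r / 2 - cabs (w - a) by near: v; exact: near_cabs_lt.
  by have := cabsD (v - w) (w - a); rewrite addrA subrK; lra.
have isK p w : bounded_annulus a r p -> inner a r w ->
    is_derive (w : C^o) 1 (K p 1%N : C^o -> C^o) (K p 2%N w).
  by move=> bp wi; apply/is_derive_cdiff; exact: (cdiff_cauchy_transform1 r0 LamP bp wi).
have K2d p : bounded_annulus a r p -> derivable (K p 2%N : C^o -> C^o) a 1.
  by move=> bp; apply/cdiffP; exact: (cdiff_cauchy_transform2 r0 LamP bp ia).
pose G (w : C^o) : C^o :=
  (K f 2%N w - f w * K (fun=> 1) 2%N w) * (K (fun=> 1) 1%N w)^-1.
have fE : {near (a : C^o), G =1 f^`()}.
  near=> w.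
  have wi : inner a r w by near: w; exact: innernear.
  have Kw : K (fun=> 1) 1%N w != 0 by near: w.
  have dfw : derivable f w 1 by apply: fd; move: wi; rewrite /inner; lra.
  have e1 : 'D_1 (f * (K (fun=> 1) 1%N : C^o -> C^o)) w = 'D_1 (K f 1%N : C^o -> C^o) w.
    apply: near_eq_derive; apply: filterS (innernear w wi) => v vi.
    exact: (cauchy_formula r0 LamP fB fcd).
  have i1 := is_deriveM (derivableP dfw) (isK _ _ b1 wi).
  rewrite (@derive_val _ _ _ _ _ _ _ i1) in e1.
  rewrite (@derive_val _ _ _ _ _ _ _ (isK _ _ bf wi)) in e1.
  by rewrite /G -e1 derive1E /GRing.scale /=; field.
apply: (near_eq_derivable fE).
apply: (@derivableM _ _ (fun w : C^o => K f 2%N w - f w * K (fun=> 1) 2%N w)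
  (fun w : C^o => (K (fun=> 1) 1%N w)^-1)).
  apply: derivableB; first exact: K2d.
  apply: (@derivableM _ _ f (K (fun=> 1) 2%N : C^o -> C^o)); last exact: K2d.
  by apply: fd; rewrite subrr cabs0.
by apply: derivableV => //; have [] := isK _ _ b1 ia.
Unshelve. all: by end_near.
Qed.

Lemma derivable_mull (c : C) (f : C^o -> C^o) (z : C^o) :
  derivable f z 1 -> derivable (fun w : C^o => c * f w : C^o) z 1.
Proof. exact: derivableZ. Qed.

Lemma derivable_mulf (f g : C^o -> C^o) (z : C^o) : derivable f z 1 ->
  derivable g z 1 -> derivable (fun w : C^o => f w * g w : C^o) z 1.
Proof. exact: derivableM. Qed.

Lemma derivable_invf (f : C^o -> C^o) (z : C^o) : f z != 0 ->
  derivable f z 1 -> derivable (fun w : C^o => (f w)^-1 : C^o) z 1.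
Proof. exact: derivableV. Qed.

Lemma derivable_subf (f g : C^o -> C^o) (z : C^o) : derivable f z 1 ->
  derivable g z 1 -> derivable (fun w : C^o => f w - g w : C^o) z 1.
Proof. exact: derivableB. Qed.

Lemma derivable_sumf n (h : 'I_n -> C^o -> C^o) (z : C^o) :
  (forall i, derivable (h i) z 1) ->
  derivable (fun w : C^o => \sum_i h i w : C^o) z 1.
Proof.
move=> hd; have -> : (fun w : C^o => \sum_i h i w) = \sum_i h i.
  by apply/funext => w; rewrite fct_sumE.
exact: derivable_sum.
Qed.

(** The radius [d] does not depend on [g]: by Cauchy's formula, [g w - g a] is controlled by the
    transforms of [g] and of 1, which are Lipschitz at [a] with a constant common to all [g] bounded
    by 1. *)
Lemma equicontinuous_center a (r : R) : 0 < r -> exists2 d : R, 0 < d &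
  forall g, (forall z, cabs (z - a) <= 2 * r -> cabs (g z) <= 1) ->
    (forall z, cabs (z - a) <= 2 * r -> exists l : C, cdiff g z l) ->
    forall w, cabs (w - a) < d -> cabs (g w - g a) <= 2^-1.
Proof.
move=> r0; have [Lam LamP] := cauchy_functional a r0.
have [LamD LamZ Lam_le _ _] := LamP.
pose K p w := cauchy_transform Lam p 1 w.
have ia := inner_center a r0.
have Ka : 0 < cabs (K (fun=> 1) a).
  by rewrite cabs_gt0; exact: cauchy_transform_center LamP.
have KB p w : (forall z, annulus a r z -> cabs (p z) <= 1) -> inner a r w ->
    cabs (K p w - K p a) <= 64 / r * cabs (w - a).
  move=> pB wi; have bp : bounded_annulus a r p by exists 1.
  have bw := bounded_annulusM bp (bounded_annulus_kernel r0 1 wi).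
  have ba := bounded_annulusM bp (bounded_annulus_kernel r0 1 ia).
  rewrite /K /cauchy_transform -[- Lam _]mulN1r -LamZ// -LamD//; last first.
    exact: bounded_annulusM (bounded_annulus_cst _ _ _) ba.
  have -> : 64 / r * cabs (w - a) = 16 * r * (2 / r * (2 / r) * cabs (w - a)).
    by field; lra.
  apply: Lam_le => z za.
  have n1 := annulus_inner_neq r0 za wi; have n2 := annulus_inner_neq r0 za ia.
  have -> : p z * (z - w)^-1 ^+ 1 + -1 * (p z * (z - a)^-1 ^+ 1) =
      p z * ((z - w)^-1 * (z - a)^-1 * (w - a)).
    by field; rewrite n1 n2.
  rewrite cabsM -[X in _ <= X]mul1r ler_pM ?cabs_ge0 ?pB//.
  rewrite cabsM ler_wpM2r ?cabs_ge0// cabsM ler_pM ?cabs_ge0//;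
    exact: (cauchy_kernel_le r0 za).
(* The second bound makes [128 / r * cabs (w - a)] at most half of [cabs (K (fun=> 1) a)]. *)
exists (Num.min (r / 2) (cabs (K (fun=> 1) a) * r / 256)).
  by rewrite lt_min !divr_gt0 ?mulr_gt0.
move=> g gB gd w; rewrite lt_min => /andP[wi wd].
have gB' z : annulus a r z -> cabs (g z) <= 1 by move=> /andP[_]; exact: gB.
have h1 := KB g w gB' wi.
have h2 : cabs (K (fun=> 1) w - K (fun=> 1) a) <= 64 / r * cabs (w - a).
  by apply: KB => // z _; rewrite cabs1.
have F v : inner a r v -> g v * K (fun=> 1) v = K g v.
  by move=> vi; exact: (cauchy_formula r0 LamP gB gd).
have e1 : (g w - g a) * K (fun=> 1) a =
    (K g w - K g a) - g w * (K (fun=> 1) w - K (fun=> 1) a).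
  by rewrite -!F//; ring.
have gw : cabs (g w) <= 1 by apply: gB; move: wi; rewrite /inner; lra.
have h3 : cabs (g w - g a) * cabs (K (fun=> 1) a) <= 128 / r * cabs (w - a).
  rewrite -cabsM e1 (le_trans (cabsB _ _))// cabsM.
  have -> : 128 / r = 64 / r + 64 / r by field; lra.
  by rewrite mulrDl lerD// -[leRHS]mul1r ler_pM ?cabs_ge0.
have h4 : 128 / r * cabs (w - a) <= 2^-1 * cabs (K (fun=> 1) a).
  by rewrite mulrAC ler_pdivrMr//; lra.
by have := le_trans h3 h4; rewrite ler_pM2r.
Qed.

(** The difference of the squares is [(1 - al^2) (1 - |z|^2)]. *)
Lemma blaschke_le (al : R) z : 0 <= al <= 1 -> cabs z <= 1 ->
  cabs (z - al%:C%C) <= cabs (1 - al%:C%C * z).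
Proof.
move=> /andP[al0 al1] z1.
rewrite -(@ler_pXn2r _ 2) ?nnegrE ?cabs_ge0// !cabs_sqr.
have : cabs z ^+ 2 <= 1 by rewrite expr_le1// cabs_ge0.
rewrite cabs_sqr; case: z z1 => p q /= _ pq.
have : 0 <= (1 - al ^+ 2) * (1 - (p ^+ 2 + q ^+ 2)).
  by rewrite mulr_ge0// subr_ge0// expr_le1.
by lra.
Qed.

(* Schwarz-Pick degenerates at a boundary value: compose [al * g], for [al < 1],
   with the disc automorphism that sends [al] to [0] and let [al] tend to [1]. *)
Lemma local_maximum_one a (r : R) g : 0 < r ->
  (forall z, cabs (z - a) <= 2 * r -> cabs (g z) <= 1) ->
  (forall z, cabs (z - a) <= 2 * r -> exists l : C, cdiff g z l) ->
  g a = 1 -> exists2 d : R, 0 < d & forall w, cabs (w - a) < d -> g w = 1.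
Proof.
move=> r0 gB gd ga; have [d d0 dP] := equicontinuous_center a r0.
exists (Num.min d r); first by rewrite lt_min d0.
move=> w; rewrite lt_min => /andP[wd wr].
have wB : cabs (g w) <= 1 by apply: gB; lra.
apply/eqP; rewrite -subr_eq0 -cabs_eq0 eq_le cabs_ge0 andbT.
(* With [al = 1 - e] and [D = |g w - 1|], the bound [al D <= (1 - al^2 + al^2 D) / 2] rearranges to
   [D (1 - e^2) <= 1 - al^2 <= 2 e]. *)
have key (e : R) : 0 < e < 1 -> cabs (g w - 1) * (1 - e ^+ 2) <= 2 * e.
  move=> /andP[e0 e1]; pose al := 1 - e.
  have [A AE] : exists A : C, A = al%:C%C by exists al%:C%C.
  have al01 : 0 <= al <= 1 by rewrite /al; apply/andP; lra.
  have cA : cabs A = al by rewrite AE cabs_real ger0_norm//; case/andP: al01.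
  have AgB z : cabs (g z) <= 1 -> cabs (A * g z) <= al.
    move=> h; rewrite cabsM cA -[leRHS]mulr1 ler_wpM2l//; by case/andP: al01.
  pose psi z := (A * g z - A) * (1 - A * (A * g z))^-1.
  have den z : cabs (g z) <= 1 -> 1 - A * (A * g z) != 0.
    move=> h; apply/eqP => /(congr1 (@cabs R)).
    rewrite cabs0 => h0; have := cabsD (1 - A * (A * g z)) (A * (A * g z)).
    rewrite subrK cabs1 h0 add0r cabsM cA => h1.
    have := AgB _ h; move: h1; rewrite /al; nra.
  have psiB z : cabs (z - a) <= 2 * r -> cabs (psi z) <= 1.
    move=> /gB h; rewrite /psi cabsM cabsV ler_pdivrMr; last first.
      by rewrite cabs_gt0 den.
    rewrite mul1r; have := AgB _ h; rewrite AE => Agz; apply: blaschke_le => //.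
    by rewrite (le_trans Agz)//; case/andP: al01.
  have psid z : cabs (z - a) <= 2 * r -> exists l : C, cdiff psi z l.
    move=> h; have /cdiffP dg := gd z h; apply/cdiffP.
    have dc (c : C) : derivable (fun=> c : C^o) (z : C^o) 1.
      exact: (@derivable_cst _ C^o C^o c).
    apply: (@derivable_mulf (fun z => A * g z - A) (fun z => (1 - A * (A * g z))^-1)).
      apply: (@derivable_subf (fun z => A * g z) (fun=> A)); last exact: dc.
      by apply: derivable_mull; exact: dg.
    apply: (@derivable_invf (fun z => 1 - A * (A * g z))); first exact/den/gB.
    apply: (@derivable_subf (fun=> 1) (fun z => A * (A * g z))); first exact: dc.
    by do 2!apply: derivable_mull; exact: dg.
  have psia : psi a = 0 by rewrite /psi ga mulr1 subrr mul0r.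
  have := dP psi psiB psid w wd; rewrite psia subr0 /psi cabsM cabsV.
  rewrite ler_pdivrMr ?cabs_gt0 ?den//.
  have -> : A * g w - A = A * (g w - 1) by ring.
  rewrite cabsM cA => h1.
  have h2 : cabs (1 - A * (A * g w)) <= (1 - al ^+ 2) + al ^+ 2 * cabs (g w - 1).
    have -> : 1 - A * (A * g w) = (1 - A * A) - A * A * (g w - 1) by ring.
    rewrite (le_trans (cabsB _ _))// !cabsM cA -expr2.
    have -> : 1 - A * A = ((1 - al ^+ 2)%:C)%C :> C.
      by rewrite AE; apply/eqP; rewrite eq_complex /=; apply/andP; split; apply/eqP; ring.
    rewrite cabs_real ger0_norm//.
    by case/andP: al01 => ? ?; rewrite subr_ge0 expr_le1.
  have h3 := cabs_ge0 (g w - 1).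
  by move: h1 h2; rewrite /al; nra.
rewrite leNgt; apply/negP => D0.
set D := cabs _ in D0 key.
have D2 : D <= 2 by rewrite /D; have := cabsB (g w) 1; rewrite cabs1; lra.
(* Since [D <= 2], the value [e = D / 8] lies strictly between 0 and 1 and gives
   [15 D / 16 <= D / 4]. *)
have := key (D / 8) ltac:(apply/andP; lra).
by nra.
Qed.

Lemma local_maximum a (r M : R) f : 0 < r ->
  (forall z, cabs (z - a) <= 2 * r -> cabs (f z) <= M) ->
  (forall z, cabs (z - a) <= 2 * r -> exists l : C, cdiff f z l) ->
  f a = M%:C%C -> exists2 d : R, 0 < d & forall w, cabs (w - a) < d -> f w = f a.
Proof.
move=> r0 fB fd fa.
have M0 : 0 <= M.
  by apply: le_trans (cabs_ge0 (f a)) _; apply: fB; rewrite subrr cabs0; lra.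
(* If [M = 0], [f] vanishes on the disc; otherwise division by [M] reduces to the value 1. *)
have [M_0|Mn0] := eqVneq M 0.
  exists r => // w wr; apply/eqP; rewrite fa M_0 -cabs_eq0 eq_le cabs_ge0 andbT.
  by rewrite -[leRHS]M_0 fB//; lra.
have Mp : 0 < M by rewrite lt_neqAle eq_sym Mn0.
have Mc : M%:C%C != 0 :> C by rewrite -cabs_gt0 cabs_real normr_gt0.
pose g z := (M^-1)%:C%C * f z.
have [d d0 dP] : exists2 d : R, 0 < d & forall w, cabs (w - a) < d -> g w = 1.
  apply: (@local_maximum_one a r) => //.
  - move=> z /fB h; rewrite /g cabsM cabs_real ger0_norm ?invr_ge0//.
    by rewrite mulrC ler_pdivrMr// mul1r.
  - move=> z /fd/cdiffP df; apply/cdiffP.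
    by apply: derivable_mull; exact: df.
  - by rewrite /g fa -rmorphM mulVf.
exists d => // w /dP; rewrite /g fmorphV => h.
by rewrite fa -[RHS]mulr1 -h mulrA mulfV// mul1r.
Qed.

(** The set where [f = f z0] is open by the local result, its complement in [Om] is open by
    continuity, and connectedness concludes. *)
Lemma maximum_modulus (Om : set C^o) f (M : R) (z0 : C) :
  open Om -> connected Om -> analytic_on Om f -> Om z0 ->
  (forall z, Om z -> cabs (f z) <= M) -> f z0 = M%:C%C ->
  forall z, Om z -> f z = f z0.
Proof.
move=> oOm cOm fd Oz0 fB fz0.
have nOm z : Om z -> exists2 d : R, 0 < d & forall w, cabs (w - z) < d -> Om w.
  by move=> Oz; apply/nbhs_cabsP; move: oOm; rewrite openE; exact.
pose D := [set z : C^o | Om z /\ f z = f z0].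
suff DE : D = Om by move=> z; rewrite -DE => -[].
have oD : open D.
  rewrite openE => a [Oa fa]; apply/nbhs_cabsP.
  have [d d0 dP] := nOm _ Oa.
  have [e e0 eP] : exists2 e : R, 0 < e & forall w, cabs (w - a) < e -> f w = f a.
    apply: (@local_maximum a (d / 4) M); rewrite ?fa//; first by lra.
      by move=> z h; apply: fB; apply: dP; lra.
    by move=> z h; apply/cdiffP/fd/dP; lra.
  exists (Num.min d e); first by rewrite lt_min d0.
  by move=> w; rewrite lt_min => /andP[/dP ? /eP ?]; split=> //; rewrite -fa.
have oE : open [set z : C^o | Om z /\ f z != f z0].
  rewrite openE => a [Oa fa]; apply/nbhs_cabsP.
  have [d d0 dP] := nOm _ Oa.
  have /cdiffP[l /cdiff_lipschitz[e e0 eP]] := fd _ Oa.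
  have m0 : 0 < cabs (f a - f z0) by rewrite cabs_gt0 subr_eq0.
  have l0 : 0 < cabs l + 1 by rewrite ltr_wpDl// cabs_ge0.
  exists (Num.min d (Num.min e (cabs (f a - f z0) / (cabs l + 1)))).
    by rewrite !lt_min d0 e0 divr_gt0.
  move=> w; rewrite !lt_min => /and3P[/dP ? h2 h3]; split=> //.
  apply/eqP => fw; have := eP _ h2; rewrite addrCA subrr addr0 fw cabs_distC.
  by move: h3; rewrite ltr_pdivlMr//; lra.
apply: cOm; first by exists z0.
  by exists D => //; apply/seteqP; split=> z /= => [[]//|[]].
exists (~` [set z : C^o | Om z /\ f z != f z0]); first by rewrite closedC.
apply/seteqP; split=> z /=.
  by move=> [Oz fz]; split=> // -[_]; rewrite fz eqxx.
by move=> [Oz nz]; split=> //; apply/eqP/negPn/negP => h; apply: nz.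
Qed.

End MaximumPrinciple.

(** * Euclidean and operator norms *)

Local Open Scope sesquilinear_scope.

Section Norms.
Variable R : realType.
Local Notation C := R[i].
Implicit Types (n d m : nat).

(** Linear in the first argument, conjugate-linear in the second. *)
Definition dotc n (x y : 'cV[C]_n) : C := (y^t* *m x) 0 0.

Lemma dotcE n (x y : 'cV[C]_n) : dotc x y = \sum_i conjc (y i 0) * x i 0.
Proof. by rewrite /dotc mxE; apply: eq_bigr => i _; rewrite !mxE. Qed.

Lemma vnorm_ge0 n (x : 'cV[C]_n) : 0 <= vnorm x.
Proof. exact: sqrtr_ge0. Qed.

Lemma vnorm_sqr n (x : 'cV[C]_n) : vnorm x ^+ 2 = \sum_i cabs (x i 0) ^+ 2.
Proof.
rewrite sqr_sqrtr; last by apply: sumr_ge0 => i _; rewrite addr_ge0 ?sqr_ge0.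
by apply: eq_bigr => i _; rewrite cabs_sqr.
Qed.

Lemma vnorm_eq0 n (x : 'cV[C]_n) : vnorm x = 0 -> x = 0.
Proof.
move=> x0; have /eqP := vnorm_sqr x; rewrite x0 expr0n eq_sym psumr_eq0; last first.
  by move=> i _; rewrite sqr_ge0.
move=> /allP h; apply/colP => i; rewrite mxE; apply/eqP; rewrite -cabs_eq0.
by rewrite -sqrf_eq0; exact: h (mem_index_enum i).
Qed.

Lemma vnormZ n c (x : 'cV[C]_n) : vnorm (c *: x) = cabs c * vnorm x.
Proof.
apply/eqP; rewrite -(@eqrXn2 _ 2) ?mulr_ge0 ?cabs_ge0 ?vnorm_ge0//.
rewrite exprMn !vnorm_sqr mulr_sumr; apply/eqP; apply: eq_bigr => i _.
by rewrite !mxE cabsM exprMn.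
Qed.

Lemma dotcxx n (x : 'cV[C]_n) : dotc x x = (vnorm x ^+ 2)%:C%C.
Proof.
rewrite dotcE vnorm_sqr rmorph_sum /=; apply: eq_bigr => i _.
by rewrite cabs_sqr add_Re2_Im2 sqr_normc mulrC.
Qed.

Lemma vnormD_sqr n (x y : 'cV[C]_n) :
  vnorm (x + y) ^+ 2 = vnorm x ^+ 2 + 2 * complex.Re (dotc x y) + vnorm y ^+ 2.
Proof.
rewrite !vnorm_sqr dotcE Re_sum mulr_sumr -!big_split /=; apply: eq_bigr => i _.
rewrite !cabs_sqr mxE; case: (x i 0) (y i 0) => a b [c e] /=; ring.
Qed.

(** A weak Cauchy-Schwarz inequality, by [2 p q <= p^2 + q^2]; it suffices when both norms have the
    same bound. *)
Lemma cabs_dotc_le n (x y : 'cV[C]_n) :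
  2 * cabs (dotc x y) <= vnorm x ^+ 2 + vnorm y ^+ 2.
Proof.
rewrite dotcE !vnorm_sqr -big_split /=.
apply: (@le_trans _ _ (2 * \sum_i (cabs (y i 0) * cabs (x i 0)))).
  rewrite ler_wpM2l// (le_trans (cabs_sum _ _))// ler_sum// => i _.
  by rewrite cabsM /cabs; case: (y i 0) => a b /=; rewrite sqrrN.
rewrite mulr_sumr ler_sum// => i _.
by have := sqr_ge0 (cabs (x i 0) - cabs (y i 0)); lra.
Qed.

(** The row sums of moduli give a bound, since each coordinate of [x] is at most 1 in modulus. This
    makes the supremum in [opnorm] meaningful. *)
Lemma opnorm_has_ubound n (A : 'M[C]_n) : has_ubound
  [set vnorm (A *m x) | x in [set x : 'cV[C]_n | vnorm x <= 1]].
Proof.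
exists (Num.sqrt (\sum_i (\sum_j cabs (A i j)) ^+ 2)) => _ [x /= x1 <-].
rewrite -[leLHS]ger0_norm ?vnorm_ge0// -sqrtr_sqr ler_wsqrtr// vnorm_sqr.
apply: ler_sum => i _; rewrite lerXn2r ?nnegrE ?cabs_ge0 ?sumr_ge0//.
  by move=> j _; rewrite cabs_ge0.
rewrite mxE (le_trans (cabs_sum _ _))// ler_sum// => j _.
rewrite cabsM -[leRHS]mulr1 ler_wpM2l ?cabs_ge0//.
apply: le_trans x1; rewrite -(@ler_pXn2r _ 2) ?nnegrE ?cabs_ge0 ?vnorm_ge0//.
by rewrite vnorm_sqr (bigD1 j)//= lerDl sumr_ge0// => k _; rewrite sqr_ge0.
Qed.

Lemma vnorm0 n : vnorm (0 : 'cV[C]_n) = 0.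
Proof. by rewrite -(scale0r (0 : 'cV[C]_n)) vnormZ cabs0 mul0r. Qed.

Lemma opnorm_ge0 n (A : 'M[C]_n) : 0 <= opnorm A.
Proof.
apply: (ub_le_sup (opnorm_has_ubound A)).
by exists 0; rewrite /= ?mulmx0 vnorm0.
Qed.

Lemma vnorm_mulmx_le n (A : 'M[C]_n) x : vnorm (A *m x) <= opnorm A * vnorm x.
Proof.
have [/vnorm_eq0->|x0] := eqVneq (vnorm x) 0.
  by rewrite mulmx0 vnorm0 mulr0.
have xp : 0 < vnorm x by rewrite lt_neqAle eq_sym x0 vnorm_ge0.
rewrite -ler_pdivrMr// mulrC.
have cE : cabs ((vnorm x)^-1)%:C%C = (vnorm x)^-1.
  by rewrite cabs_real ger0_norm// invr_ge0 vnorm_ge0.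
apply: (ub_le_sup (opnorm_has_ubound A)); exists (((vnorm x)^-1)%:C%C *: x) => /=.
  by rewrite vnormZ cE mulVf.
by rewrite -scalemxAr vnormZ cE.
Qed.

Lemma dotcZr n (x y : 'cV[C]_n) c :
  dotc x (c *: y) = conjc c * dotc x y.
Proof.
rewrite !dotcE mulr_sumr; apply: eq_bigr => i _; rewrite !mxE rmorphM /=.
by rewrite mulrA.
Qed.

(* [M^2 |x|^2 - |A x|^2] is a nonnegative Hermitian form, so a vector where it
   vanishes lies in its kernel. *)
Lemma maximizer_dotc n (A : 'M[C]_n) (M : R) x y :
  (forall z, vnorm (A *m z) <= M * vnorm z) -> vnorm (A *m x) = M * vnorm x ->
  dotc (A *m x) (A *m y) = (M ^+ 2)%:C%C * dotc x y.
Proof.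
move=> AM Ax; apply/eqP; rewrite -subr_eq0; set D := _ - _.
pose K := M ^+ 2 * vnorm y ^+ 2 - vnorm (A *m y) ^+ 2.
have sq z : vnorm (A *m z) ^+ 2 <= M ^+ 2 * vnorm z ^+ 2.
  rewrite -exprMn lerXn2r ?nnegrE ?vnorm_ge0//.
  exact: le_trans (vnorm_ge0 _) (AM z).
have K0 : 0 <= K by rewrite subr_ge0.
(* The form is nonnegative at [x + t y] and vanishes at [x], which leaves the cross term against
   [|t|^2 K]. *)
have main t : 2 * complex.Re (conjc t * D) <= cabs t ^+ 2 * K.
  have := sq (x + t *: y); rewrite mulmxDr -scalemxAr !vnormD_sqr !vnormZ Ax.
  rewrite !dotcZr.
  have -> : complex.Re (conjc t * D) = complex.Re (conjc t * dotc (A *m x) (A *m y)) -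
      M ^+ 2 * complex.Re (conjc t * dotc x y).
    rewrite /D; case: (t) (dotc _ (A *m y)) (dotc x y) => ? ? [? ?] [? ?] /=; ring.
  rewrite /K.
  by lra.
have e0 : 0 < (K + 1)^-1 by rewrite invr_gt0; lra.
(* The choice [t = e D] with [e = 1 / (K + 1)] yields [2 e |D|^2 <= e^2 K |D|^2 = e (1 - e) |D|^2],
   hence [D = 0]. *)
have := main (((K + 1)^-1)%:C%C * D).
have -> : complex.Re (conjc (((K + 1)^-1)%:C%C * D) * D) = (K + 1)^-1 * cabs D ^+ 2.
  by rewrite cabs_sqr; case: (D) => ? ? /=; ring.
rewrite cabsM cabs_real gtr0_norm// exprMn.
set e := (K + 1)^-1 in e0 *.
have eK : e * K = 1 - e by rewrite /e; field; lra.
rewrite (_ : e ^+ 2 * cabs D ^+ 2 * K = (e * K) * (e * cabs D ^+ 2)); last by ring.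
rewrite eK => h; rewrite -cabs_eq0 -sqrf_eq0 eq_le sqr_ge0 andbT.
have : e * cabs D ^+ 2 <= 0 by have := sqr_ge0 (cabs D); nra.
by rewrite pmulr_rle0.
Qed.

End Norms.

(** * Orthonormal bases and the block form *)

Section BlockForm.
Variable R : realType.
Local Notation C := R[i].
Implicit Types (n d m k : nat).

Lemma trmxC_mul n k m (P : 'M[C]_(n, k)) (Q : 'M[C]_(k, m)) :
  (P *m Q)^t* = Q^t* *m P^t*.
Proof. by rewrite trmx_mul map_mxM. Qed.

Lemma trmxC_scale_real n k (c : R) (P : 'M[C]_(n, k)) :
  (c%:C%C *: P)^t* = c%:C%C *: P^t*.
Proof. by rewrite linearZ /= map_mxZ; congr (_ *: _); exact: conjc_real. Qed.

Lemma gram_entry n k m (P : 'M[C]_(n, k)) (Q : 'M[C]_(n, m)) i j :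
  (P^t* *m Q) i j = dotc (col j Q) (col i P).
Proof. by rewrite /dotc !mxE; apply: eq_bigr => l _; rewrite !mxE. Qed.

Lemma maximizer_gram n k m (A : 'M[C]_n) (M : R) (E : 'M[C]_(n, k))
    (Y : 'M[C]_(n, m)) :
  (forall z, vnorm (A *m z) <= M * vnorm z) ->
  (forall j, vnorm (A *m col j E) = M * vnorm (col j E)) ->
  (A *m E)^t* *m (A *m Y) = (M ^+ 2)%:C%C *: (E^t* *m Y).
Proof.
move=> AM AE.
(* Adjoints bring the maximizing vector into the first argument, where [maximizer_dotc] expects
   it. *)
have -> : (A *m E)^t* *m (A *m Y) = ((A *m Y)^t* *m (A *m E))^t*.
  by rewrite [RHS]trmxC_mul trmxCK.
have -> : E^t* *m Y = (Y^t* *m E)^t* by rewrite [RHS]trmxC_mul trmxCK.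
rewrite -trmxC_scale_real; congr (_^t*); apply/matrixP => i j.
have colM (p : nat) (Z : 'M[C]_(n, p)) l : col l (A *m Z) = A *m col l Z.
  by rewrite !colE mulmxA.
by rewrite gram_entry !colM (maximizer_dotc _ AM)// mxE gram_entry.
Qed.

Lemma maximizer_image_orthonormal n k (A : 'M[C]_n) (M : R) (E : 'M[C]_(n, k)) :
  0 < M -> (forall z, vnorm (A *m z) <= M * vnorm z) ->
  (forall j, vnorm (A *m col j E) = M * vnorm (col j E)) -> E^t* *m E = 1%:M ->
  ((M^-1)%:C%C *: (A *m E))^t* *m ((M^-1)%:C%C *: (A *m E)) = 1%:M.
Proof.
move=> M0 AM AE EE.
rewrite trmxC_scale_real -scalemxAl -scalemxAr (maximizer_gram E AM AE) EE.
by rewrite !scalerA -!rmorphM (_ : _ * _ = 1) ?scale1r//; field; lra.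
Qed.

Lemma orthonormal_basis n d (B : 'M[C]_(d, n)) : row_free B ->
  exists E : 'M[C]_(n, d), E^t* *m E = 1%:M /\
    forall j, ((col j E)^T <= B)%MS.
Proof.
move=> fB; have dn : (d <= n)%N by rewrite -(eqP fB) rank_leq_col.
have /unitarymxP QU := schmidt_unitarymx B dn.
exists (schmidt B)^T; split.
  (* Conjugating [Q Q^* = 1] entrywise, for [Q = schmidt B], gives [E^* E = 1] for the transpose [E]
     of [Q]; the plain transpose keeps the columns of [E] in the row space of [B]. *)
  have := congr1 (map_mx (@Num.conj C)) QU.
  rewrite map_mxM map_mx1 => <-; apply/matrixP => i j.
  rewrite !mxE; apply: eq_bigr => l _; rewrite !mxE.
  by apply: (congr2 *%R) => //; exact/esym/conjCK.
move=> j; rewrite tr_col trmxK -(eqmx_schmidt_free fB).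
exact: row_sub.
Qed.

(** Gram-Schmidt on a basis of the orthogonal complement of the columns of [E], which has dimension
    [m]. *)
Lemma orthonormal_complete d m (E : 'M[C]_(d + m, d)) : E^t* *m E = 1%:M ->
  exists W : 'M[C]_(d + m, m), W^t* *m W = 1%:M /\ E^t* *m W = 0.
Proof.
move=> EE.
have QU : E^t* \is unitarymx by apply/unitarymxP; rewrite trmxCK.
have rk : m = \rank (orthomx (@Num.conj C) (hermitian1mx (d + m)) (E^t*)).
  by rewrite rank_ortho mxrank_unitary// addKn.
suff [W [W1 W2]] : exists W : 'M[C]_(m, d + m), W *m W^t* = 1%:M /\ W *m E = 0.
  exists (W^t*); split; first by rewrite trmxCK.
  by rewrite -[E^t* *m _]trmxCK trmxC_mul !trmxCK W2 trmx0 map_mx0.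
move: rk; set H := orthomx _ _ _ => rk.
suff: forall k, k = \rank H -> (k <= d + m)%N ->
    exists W : 'M[C]_(k, d + m), W *m W^t* = 1%:M /\ W *m E = 0.
  by apply=> //; rewrite leq_addl.
move=> k -> kn; exists (schmidt (row_base H)); split.
  by apply/unitarymxP; exact: schmidt_unitarymx.
have : (schmidt (row_base H) <= H)%MS.
  by rewrite (eqmx_schmidt_free (row_base_free H)) eq_row_base.
by move=> /orthomx1P; rewrite trmxCK.
Qed.

Lemma unitary_row_mx d m (E : 'M[C]_(d + m, d)) (W : 'M[C]_(d + m, m)) :
  E^t* *m E = 1%:M -> W^t* *m W = 1%:M -> E^t* *m W = 0 ->
  unitary (row_mx E W).
Proof.
move=> EE WW EW.
have h : (row_mx E W)^t* *m row_mx E W = 1%:M.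
  rewrite tr_row_mx map_col_mx mul_col_row EE WW EW.
  have -> : W^t* *m E = 0.
    by rewrite -[LHS]trmxCK trmxC_mul trmxCK EW trmx0 map_mx0.
  by rewrite scalar_mx_block.
by split=> //; exact: mulmx1C.
Qed.

(** [U] and [V] are chosen before [G], so that one pair serves for all values [F z]. The first [d]
    columns of [U] are those of [A E / M], and the first [d] columns of the adjoint of [V] are those
    of [E]. *)
Lemma block_decomposition d m (A : 'M[C]_(d + m)) (M : R) (E : 'M[C]_(d + m, d)) :
  0 < M -> (forall z, vnorm (A *m z) <= M * vnorm z) ->
  (forall j, vnorm (A *m col j E) = M * vnorm (col j E)) -> E^t* *m E = 1%:M ->
  exists U V : 'M[C]_(d + m), [/\ unitary U, unitary V &
    forall G : 'M[C]_(d + m), (forall z, vnorm (G *m z) <= M * vnorm z) ->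
      G *m E = A *m E ->
      G = U *m block_mx (M%:C%C)%:M 0 0
        (drsubmx (mxstar U *m G *m mxstar V)) *m V].
Proof.
move=> M0 AM AE EE.
have Mc : M%:C%C != 0 :> C by rewrite -cabs_gt0 cabs_real normr_gt0 gt_eqF.
have [W [WW EW]] := orthonormal_complete EE.
pose P := (M^-1)%:C%C *: (A *m E).
have AEP : A *m E = M%:C%C *: P by rewrite scalerA -rmorphM mulfV ?gt_eqF// scale1r.
have PP := maximizer_image_orthonormal M0 AM AE EE.
have [W' [WW' PW']] := orthonormal_complete PP.
have uU := unitary_row_mx PP WW' PW'; have uX := unitary_row_mx EE WW EW.
set U := row_mx P W' in uU; set X := row_mx E W in uX.
exists U, (X^t*); split=> //.
  by case: uX => x1 x2; split; rewrite /mxstar ?trmxCK.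
move=> G GM GE; rewrite [mxstar (X^t*)]trmxCK.
have TE : mxstar U *m G *m X = block_mx (M%:C%C)%:M 0 0 (W'^t* *m G *m W).
  rewrite /mxstar /U /X tr_row_mx map_col_mx mul_col_mx mul_col_row.
  congr block_mx.
  - by rewrite -mulmxA GE AEP -scalemxAr PP scalemx1.
  (* The upper right block is [M^-1 (G E)^* (G W) = M E^* W = 0], since the columns of [E] are
     maximizing for [G] too. *)
  - rewrite -mulmxA /P -GE trmxC_scale_real -scalemxAl (maximizer_gram _ GM).
      by rewrite EW !scaler0.
    move=> j; have colM (Z : 'M[C]_(d + m)) : Z *m col j E = col j (Z *m E).
      by rewrite !colE mulmxA.
    by rewrite colM GE -colM.
  (* The lower left block vanishes since the columns of [W'] are orthogonal to [G E = M P]. *)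
  - rewrite -mulmxA GE AEP -scalemxAr.
    by rewrite -[_ *m P]trmxCK trmxC_mul trmxCK PW' trmx0 map_mx0 scaler0.
rewrite TE block_mxKdr -TE; case: uU uX => [_ u2] [_ x2].
by rewrite !mulmxA u2 mul1mx -mulmxA [X *m _]x2 mulmx1.
Qed.

(** * Analytic matrix functions and higher derivatives *)

Lemma mx_analytic_mul n k (Om : set C^o) (F : C -> 'M[C]_n)
    (P : 'M[C]_(k, n)) (Q : 'M[C]_(n, k)) : mx_analytic_on Om F ->
  mx_analytic_on Om (fun z => P *m F z *m Q).
Proof.
move=> Fd i j z Oz.
have -> : (fun z : C^o => (P *m F z *m Q) i j : C^o) =
    (fun z => \sum_l (Q l j * \sum_p (P i p * F z p l))).
  apply/funext => w; rewrite mxE; apply: eq_bigr => l _; rewrite mulrC; congr (_ * _).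
  by rewrite mxE.
apply: derivable_sumf => l; apply: derivable_mull.
by apply: derivable_sumf => p; apply: derivable_mull; exact: Fd.
Qed.

(** Meant for [k = d + m - d], equal to [m] only propositionally; once the cast is eliminated,
    [conform_mx] meets equal sizes and is the identity. *)
Lemma blkdiag_castmx d m k (e : m = k) (c : C) (T : 'M[C]_m) :
  conform_mx (0 : 'M[C]_(d + m)) (block_mx (c%:M : 'M[C]_d) 0 0 (castmx (e, e) T)) =
  block_mx c%:M 0 0 T.
Proof. by case: _ / e; rewrite castmx_id conform_mx_id. Qed.

Lemma mx_analytic_castmx m k (e : m = k) (Om : set C^o) (T : C -> 'M[C]_m) :
  mx_analytic_on Om T -> mx_analytic_on Om (fun z => castmx (e, e) (T z)).
Proof.
case: _ / e => Td i j z Oz.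
have -> : (fun z : C^o => castmx (erefl m, erefl m) (T z) i j : C^o) =
    (fun z => T z i j) by apply/funext => w; rewrite castmx_id.
exact: Td.
Qed.

Lemma analytic_derive1n (Om : set C^o) (f : C^o -> C^o) k :
  open Om -> analytic_on Om f -> analytic_on Om (derive1n k f).
Proof.
move=> oOm fd; elim: k => [//|k IH] z Oz.
have [d d0 dP] : exists2 d : R, 0 < d & forall w, cabs (w - z) < d -> Om w.
  by apply/nbhs_cabsP; move: oOm; rewrite openE; exact.
by apply: (derivable_derive1 d0) => w /dP; exact: IH.
Qed.

(** A combination that is constant on an open set has derivative 0; from order 1 on it is constantly
    0, and the step repeats. *)
Lemma derive1n_lincomb_cst n (Om : set C^o) (f : 'I_n -> C^o -> C^o) (x : 'I_n -> C) :
  open Om -> (forall j, analytic_on Om (f j)) ->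
  (forall z w, Om z -> Om w -> \sum_j f j z * x j = \sum_j f j w * x j) ->
  forall k, (0 < k)%N -> forall z, Om z -> \sum_j derive1n k (f j) z * x j = 0.
Proof.
move=> oOm fd fc.
have step k : (forall z w, Om z -> Om w ->
    \sum_j derive1n k (f j) z * x j = \sum_j derive1n k (f j) w * x j) ->
    forall z, Om z -> \sum_j derive1n k.+1 (f j) z * x j = 0.
  move=> kc z Oz; pose c := \sum_j derive1n k (f j) z * x j.
  have dk j : derivable (derive1n k (f j) : C^o -> C^o) z 1.
    exact: (analytic_derive1n oOm (fd j) Oz).
  pose h j : C^o -> C^o := x j \*: derive1n k (f j).
  have dh j : derivable (h j) z 1 by apply: derivableZ; exact: dk.
  transitivity ('D_1 (\sum_j h j : C^o -> C^o) z).
    rewrite derive_sum//; apply: eq_bigr => j _; rewrite (deriveZ _ (dk j)).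
    by rewrite -derive1E [LHS]mulrC.
  transitivity ('D_1 (cst (c : C^o) : C^o -> C^o) z); last exact: derive_cst.
  apply: (@near_eq_derive _ C^o C^o).
  have Onz : \forall w \near z, Om w by exact: open_nbhs_nbhs.
  apply: filterS Onz => w Ow; rewrite fct_sumE /c (kc z w Oz Ow).
  by apply: eq_bigr => j _; rewrite mulrC.
elim=> [//|[|k] IH _]; first exact: step.
by apply: step => z w Oz Ow; transitivity (0 : C); [|symmetry]; exact: IH.
Qed.

End BlockForm.

(** * Constancy on maximizing vectors and the decomposition theorem *)

Lemma maximizer_constant (R : realType) n (Om : set (R[i])^o)
    (F : R[i] -> 'M[R[i]]_n) (z0 : R[i]) (x : 'cV[R[i]]_n) :
  region Om -> mx_analytic_on Om F -> Om z0 ->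
  (forall z, Om z -> opnorm (F z) <= opnorm (F z0)) ->
  vnorm (F z0 *m x) = opnorm (F z0) * vnorm x ->
  forall z, Om z -> F z *m x = F z0 *m x.
Proof.
move=> [_ oOm cOm] Fd Oz0 FM Fx.
set y := F z0 *m x; pose m := vnorm y.
have Fm z : Om z -> vnorm (F z *m x) <= m.
  move=> Oz; have -> : m = opnorm (F z0) * vnorm x by exact: Fx.
  apply: le_trans (vnorm_mulmx_le _ _) _.
  by apply: ler_wpM2r; [exact: vnorm_ge0 | exact: FM].
have Fm2 z : Om z -> vnorm (F z *m x) ^+ 2 <= m ^+ 2.
  by move=> Oz; apply: lerXn2r; rewrite ?nnegrE; [exact: vnorm_ge0..|exact: Fm].
pose f z := dotc (F z *m x) y.
have fd : analytic_on Om f.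
  move=> z Oz.
  have -> : f = (fun z => \sum_i (conjc (y i 0) * \sum_j (x j 0 * F z i j))).
    apply/funext => w; rewrite /f dotcE; apply: eq_bigr => i _; congr (_ * _).
    by rewrite mxE; apply: eq_bigr => j _; rewrite mulrC.
  apply: derivable_sumf => i; apply: derivable_mull.
  by apply: derivable_sumf => j; apply: derivable_mull; exact: Fd.
have fB z : Om z -> cabs (f z) <= m ^+ 2.
  move=> Oz; have h : 2 * cabs (f z) <= vnorm (F z *m x) ^+ 2 + m ^+ 2.
    exact: cabs_dotc_le.
  by have h' := Fm2 z Oz; lra.
have f0 : f z0 = (m ^+ 2)%:C%C by exact: dotcxx.
move=> z Oz; have := maximum_modulus oOm cOm fd Oz0 fB f0 Oz.
rewrite f0 => fz; apply/eqP; rewrite -subr_eq0; apply/eqP/vnorm_eq0.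
apply/eqP; rewrite -sqrf_eq0 eq_le sqr_ge0 andbT.
(* The cross term is [f z - f z0 = 0], so [|F z x|^2 = |F z x - y|^2 + m^2], while the left side is
   at most [m^2]. *)
have e : vnorm (F z *m x) ^+ 2 = vnorm (F z *m x - y) ^+ 2 +
    2 * complex.Re (dotc (F z *m x - y) y) + m ^+ 2.
  by rewrite -vnormD_sqr subrK.
have d0 : dotc (F z *m x - y) y = f z - f z0 by rewrite /f /dotc mulmxBr !mxE.
rewrite d0 fz f0 subrr mulr0 addr0 in e.
by have h := Fm2 z Oz; rewrite e in h; lra.
Qed.

Theorem theorem8 (R : realType) (n : nat) (Om : set (R[i])^o)
  (F : R[i] -> 'M[R[i]]_n) (z0 : R[i]) :
  region Om -> mx_analytic_on Om F -> Om z0 ->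
  (forall z, Om z -> opnorm (F z) <= opnorm (F z0)) ->
  forall d : nat,
  has_dim [set x | vnorm (F z0 *m x) = opnorm (F z0) * vnorm x] d ->
  [/\ (d = n -> exists U V : 'M[R[i]]_n,
         [/\ unitary U, unitary V &
             forall z, Om z -> F z = cR (opnorm (F z0)) *: (U *m V)]),
      ((d < n)%N -> exists (U V : 'M[R[i]]_n) (Rf : R[i] -> 'M[R[i]]_(n - d)),
         [/\ unitary U, unitary V, mx_analytic_on Om Rf &
             forall z, Om z ->
               F z = U *m @blkdiag R n d (cR (opnorm (F z0))) (Rf z) *m V])
    & forall x : 'cV[R[i]]_n,
        vnorm (F z0 *m x) = opnorm (F z0) * vnorm x ->
        (forall z w, Om z -> Om w -> F z *m x = F w *m x) /\
        (forall k : nat, (0 < k)%N -> mxderive k F z0 *m x = 0)].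
Proof.
move=> rOm Fd Oz0 FM d [B [fB BP]].
have Fx x := maximizer_constant (x := x) rOm Fd Oz0 FM.
have Fle z v : Om z -> vnorm (F z *m v) <= opnorm (F z0) * vnorm v.
  move=> Oz; apply: le_trans (vnorm_mulmx_le _ _) _.
  by apply: ler_wpM2r; [exact: vnorm_ge0 | exact: FM].
have [E [EE EB]] := orthonormal_basis fB.
have Emax j : vnorm (F z0 *m col j E) = opnorm (F z0) * vnorm (col j E).
  exact/(BP (col j E))/EB.
have FE z : Om z -> F z *m E = F z0 *m E.
  move=> Oz; apply/matrixP => i j.
  have /colP/(_ i) := Fx (col j E) (Emax j) z Oz.
  by rewrite !colE !mulmxA -!colE !mxE.
have un1 k : unitary (1%:M : 'M[R[i]]_k).
  have s1 : mxstar (1%:M : 'M[R[i]]_k) = 1%:M by rewrite /mxstar trmx1 map_mx1.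
  by split; rewrite s1 mulmx1.
(* The zero norm is treated apart, because the image basis is normalized by division by the norm. *)
have F0 : opnorm (F z0) = 0 -> forall z, Om z -> F z = 0.
  move=> M0 z Oz; apply/matrixP => i j.
  have /vnorm_eq0/colP/(_ i) : vnorm (F z *m delta_mx j 0) = 0.
    apply/eqP; rewrite eq_le vnorm_ge0 andbT.
    by rewrite (le_trans (Fle _ _ Oz))// M0 mul0r.
  by rewrite -colE !mxE.
have Mpos : opnorm (F z0) != 0 -> 0 < opnorm (F z0).
  by move=> Mn0; rewrite lt_neqAle eq_sym Mn0 opnorm_ge0.
split.
- move=> dn; subst d.
  have [M0|/Mpos Mp] := eqVneq (opnorm (F z0)) 0.
    exists 1%:M, 1%:M; split=> // z Oz.
    by rewrite F0// M0 (_ : cR 0 = 0 :> R[i])// scale0r.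
  (* Here [E] is square, hence unitary, so [F z E = F z0 E] determines [F z]; [U] is [F z0 E]
     divided by the norm and [V] is the adjoint of [E]. *)
  pose P := ((opnorm (F z0))^-1)%:C%C *: (F z0 *m E).
  have PP := maximizer_image_orthonormal Mp (fun v => Fle z0 v Oz0) Emax EE.
  exists P, (E^t*); split.
  + by split=> //; exact: mulmx1C.
  + by split; rewrite /mxstar trmxCK//; exact: mulmx1C.
  move=> z Oz; rewrite (_ : cR (opnorm (F z0)) = (opnorm (F z0))%:C%C)//.
  rewrite scalemxAl /P scalerA -rmorphM mulfV ?gt_eqF// scale1r.
  by rewrite -(FE z Oz) -mulmxA (mulmx1C EE) mulmx1.
- move=> dn; have [m nE] : exists m, n = (d + m)%N.
    by exists (n - d)%N; rewrite subnKC// ltnW.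
  subst n; have mE : m = (d + m - d)%N by rewrite addKn.
  have [M0|/Mpos Mp] := eqVneq (opnorm (F z0)) 0.
    exists 1%:M, 1%:M, (fun=> castmx (mE, mE) 0); split=> //.
      by apply: mx_analytic_castmx => i j z Oz; exact: derivable_cst.
    move=> z Oz; rewrite F0// M0 /blkdiag blkdiag_castmx mul1mx mulmx1.
    by rewrite (_ : cR 0 = 0 :> R[i])// raddf0 block_mx0.
  have [U [V [uU uV H]]] := block_decomposition Mp (fun v => Fle z0 v Oz0) Emax EE.
  exists U, V, (fun z => castmx (mE, mE) (drsubmx (mxstar U *m F z *m mxstar V))).
  split=> //.
    apply: mx_analytic_castmx => i j z Oz.
    have TV : mx_analytic_on Om (fun z => mxstar U *m F z *m mxstar V).
      exact: mx_analytic_mul.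
    have -> : (fun z : (R[i])^o =>
          drsubmx (mxstar U *m F z *m mxstar V) i j : (R[i])^o) =
        (fun z => (mxstar U *m F z *m mxstar V) (rshift d i) (rshift d j)).
      by apply/funext => w; rewrite !mxE.
    exact: TV.
  move=> z Oz; rewrite /blkdiag blkdiag_castmx.
  by apply: H; [move=> v; exact: Fle | exact: FE].
- move=> x xmax; split=> [z w Oz Ow|k k0]; first by rewrite !(Fx x xmax).
  apply/colP => i; rewrite !mxE.
  (* Each coordinate is a combination of derivatives of entries with the constant coefficients
     [x j 0], to which the constancy of [F z x] applies. *)
  transitivity (\sum_j derive1n k (fun w : (R[i])^o => F w i j : (R[i])^o) z0 * x j 0).
    by apply: eq_bigr => j _; rewrite mxE.
  case: rOm => _ oOm _.
  have e v : \sum_j F v i j * x j 0 = (F v *m x) i 0 by rewrite mxE.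
  apply: (@derive1n_lincomb_cst R n Om (fun j w => F w i j) (fun j => x j 0) oOm
    (fun j => Fd i j)); [|exact: k0|exact: Oz0].
  by move=> z w Oz Ow; rewrite !e (Fx x xmax z Oz) (Fx x xmax w Ow).
Qed.
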